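(* Suppose that $\mu_{\widehat{F}}+\mu_R>0$. Let $x^\star$ be the unique minimizer of $\Psi$. Let $\kappa\in(0,1)$ and $\gamma_0\in(0,2(1-\kappa)/L_{\widehat{F}})$. Set $\gamma_1=\gamma_0$ and $$\gamma_{k+1}=\frac{-\gamma_k^2\mu_{\widehat{F}}\kappa+\gamma_k\sqrt{(\gamma_k\mu_{\widehat{F}}\kappa)^2+1+2\gamma_k\mu_R}}{1+2\gamma_k\mu_R},\quad\text{for every }k\geq1.$$ Suppose that $\eta\geq\|\widehat{K}\|^2$, where $\|\widehat{K}\|^2=\max_m\|K_m\|^2$ or, in the case $F_1=\cdots=F_M$, $\|\widehat{K}\|^2=\big\|\sum_{m=1}^M\omega_mK_m^*K_m\big\|$. Then in the Distributed PD3O Algorithm with these stepsizes, there exists $\hat{c}_0>0$ such that, for every $k\geq1$, $$\|x^{k+1}-x^\star\|^2\leq\frac{\gamma_{k+1}^2}{1-\gamma_{k+1}\mu_{\widehat{F}}\kappa}\,\hat{c}_0=O\big(1/k^2\big).$$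
   Context: Let $M\geq1$. $\mathcal{X}$ and $\mathcal{U}_1,\ldots,\mathcal{U}_M$ are finite-dimensional real Hilbert spaces; $K_m:\mathcal{X}\to\mathcal{U}_m$ are linear operators with adjoints $K_m^*$; $R:\mathcal{X}\to\mathbb{R}\cup\{+\infty\}$ and $H_m:\mathcal{U}_m\to\mathbb{R}\cup\{+\infty\}$ are proper, closed, convex; $F_m:\mathcal{X}\to\mathbb{R}$ are convex and $L_{F_m}$-smooth, $L_{F_m}>0$ (differentiable with $L_{F_m}$-Lipschitz gradient). Set $$\Psi(x)=\frac1M\sum_{m=1}^M\big(F_m(x)+H_m(K_mx)\big)+R(x).$$ $(\omega_m)_{m=1}^M$ are positive weights with $\sum_m\omega_m=1$. $G^*$ denotes the convex conjugate of $G$ and $\mathrm{prox}_G(z)=\arg\min_{z'}\{G(z')+\frac12\|z-z'\|^2\}$. Constants: $L_{\widehat{F}}>0$ is such that $\frac{1}{M^2}\sum_{m=1}^M\frac{1}{\omega_m}\|\nabla F_m(x)-\nabla F_m(x')\|^2\leq L_{\widehat{F}}^2\|x-x'\|^2$ for every $(x,x')\in\mathcal{X}^2$. $\mu_{\widehat{F}}\geq0$ is such that $x\mapsto\frac1M\sum_{m=1}^MF_m(x)-\frac{\mu_{\widehat{F}}}{2}\|x\|^2$ is convex. $\mu_R\geq0$ is such that $R-\frac{\mu_R}{2}\|\cdot\|^2$ is convex. Standing assumption: there exists $x^\star\in\mathcal{X}$ with $0\in\frac1M\sum_{m=1}^M\big(\nabla F_m(x^\star)+K_m^*\partial H_m(K_mx^\star)\big)+\partial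 R(x^\star)$. Distributed PD3O Algorithm: given positive stepsizes $(\gamma_k)_{k\in\mathbb{N}}$, $\eta>0$, $q_m^0\in\mathcal{X}$, $u_m^0\in\mathcal{U}_m$, set $a_m^0=q_m^0-K_m^*u_m^0$, $m=1,\ldots,M$. For $k=0,1,\ldots$ iterate: $x^{k+1}=\mathrm{prox}_{\gamma_kR}\big(\frac{\gamma_k}{M}\sum_{m=1}^Ma_m^k\big)$ and, for $m=1,\ldots,M$, $$q_m^{k+1}=\tfrac{M\omega_m}{\gamma_{k+1}}x^{k+1}-\nabla F_m(x^{k+1}),$$ $$u_m^{k+1}=\mathrm{prox}_{M\omega_mH_m^*/(\gamma_{k+1}\eta)}\Big(u_m^k+\tfrac1\eta K_m\big(\tfrac{M\omega_m}{\gamma_k}x^{k+1}+q_m^{k+1}-q_m^k\big)\Big),$$ $$a_m^{k+1}=q_m^{k+1}-K_m^*u_m^{k+1}.$$ *)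

(* Defs.v *)
From HB Require Import structures.
From mathcomp Require Import all_boot all_order all_algebra.
From mathcomp Require Import sesquilinear.
From mathcomp Require Import all_classical all_reals all_analysis.
Set Implicit Arguments.
Unset Strict Implicit.
Unset Printing Implicit Defensive.
Import Order.TTheory GRing.Theory Num.Theory.
Import numFieldNormedType.Exports.
Local Open Scope classical_set_scope.
Local Open Scope ring_scope.

HB.mixin Record NormedModule_hasInner (R : realType) V of NormedModule R V := {
  inner : {dot V for idfun};
  inner_norm : forall x : V, `|x| ^+ 2 = inner x x
}.

#[short(type="fdHilbertType")]
HB.structure Definition FdHilbert (R : realType) :=
  {V of Vector R V & CompleteNormedModule R V & NormedModule_hasInner R V}.

Section Hilbert.
Context {R : realType}.
Implicit Types V W : fdHilbertType R.

(* The Riesz representative of l, which exists and is unique for every linear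
   form l; the value is 0 when l is not linear. *)
Definition riesz V (l : V -> R) : V :=
  xget 0 [set v | forall y, l y = inner v y].

Definition grad V (f : V -> R) (x : V) : V := riesz ('d f x).

Definition adjoint V W (K : V -> W) (u : W) : V :=
  riesz (fun x => inner (K x) u).

Definition opnorm V W (K : V -> W) : R :=
  sup [set `|K x| | x in [set x | `|x| <= 1]].

Definition smooth V (L : R) (f : V -> R) : Prop :=
  (forall x, differentiable f x) /\ L.-lipschitz (grad f).

End Hilbert.

Section ConvexAnalysis.
Context {R : realType} {V : fdHilbertType R}.
Local Open Scope ereal_scope.
Implicit Types G : V -> \bar R.

Definition proper_fun G : Prop :=
  (forall x, -oo < G x) /\ (exists x, G x < +oo).

(* To be used on functions that never take the value -oo: then the right-hand
   side never involves +oo - oo, and 0 * +oo = 0 makes t = 0, 1 harmless. *)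
Definition convex_efun G : Prop :=
  forall (x y : V) (t : R), (0 <= t <= 1)%R ->
    G (t *: x + (1 - t) *: y)%R <= t%:E * G x + (1 - t)%:E * G y.

Definition proper_closed_convex G : Prop :=
  [/\ proper_fun G, lower_semicontinuous G & convex_efun G].

Definition subdiff G (x : V) : set V :=
  [set g | forall y, G x + (inner g (y - x)%R)%:E <= G y].

Definition conjugate G (u : V) : \bar R :=
  ereal_sup [set (inner u v)%:E - G v | v in setT].

Definition argmin G : set V := [set x | forall y, G x <= G y].

(* For G proper closed convex the argmin is a singleton. *)
Definition prox G (z : V) : V :=
  xget 0%R (argmin (fun z' => G z' + (2^-1 * `|z - z'| ^+ 2)%:E)).

End ConvexAnalysis.

Section Problem.
Context {R : realType} {X : fdHilbertType R} {M : nat}.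
Context {U : 'I_M -> fdHilbertType R}.
Variables (F : 'I_M -> X -> R) (H : forall m, U m -> \bar R).
Variables (K : forall m, {linear X -> U m}) (Reg : X -> \bar R).

Definition Psi (x : X) : \bar R :=
  ((M%:R^-1)%:E * (\sum_(m < M) ((F m x)%:E + H (K m x))) + Reg x)%E.

(* 0 \in M^-1 \sum_m (grad F_m x + K_m^* (subdiff H_m (K_m x))) + subdiff Reg x *)
Definition critical (x : X) : Prop :=
  exists (h : forall m, U m) (r : X),
    [/\ forall m, subdiff (@H m) (K m x) (h m),
        subdiff Reg x r &
        0 = M%:R^-1 *: (\sum_(m < M) (grad (F m) x + adjoint (K m) (h m))) + r].

(* The term x 0 is not constrained and plays no role. *)
Definition distributed_PD3O (omega : 'I_M -> R) (gamma : nat -> R) (eta : R)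
    (x : nat -> X) (q : 'I_M -> nat -> X) (u : forall m, nat -> U m)
    (a : 'I_M -> nat -> X) : Prop :=
  [/\ forall m, a m 0%N = q m 0%N - adjoint (K m) (u m 0%N),
      forall k, x k.+1 = prox (fun z => (gamma k)%:E * Reg z)%E
                              ((gamma k / M%:R) *: \sum_(m < M) a m k),
      forall m k, q m k.+1 =
        (M%:R * omega m / gamma k.+1) *: x k.+1 - grad (F m) (x k.+1),
      forall m k, u m k.+1 =
        prox (fun z => (M%:R * omega m / (gamma k.+1 * eta))%:E
                       * conjugate (@H m) z)%E
             (u m k + eta^-1 *:
                K m ((M%:R * omega m / gamma k) *: x k.+1
                     + q m k.+1 - q m k)) &
      forall m k, a m k.+1 = q m k.+1 - adjoint (K m) (u m k.+1)].

End Problem.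

(* Main.v *)
Require Import Defs.
From HB Require Import structures.
From mathcomp Require Import all_boot all_order all_algebra.
From mathcomp Require Import sesquilinear.
From mathcomp Require Import all_classical all_reals all_analysis.
From mathcomp Require Import ring lra.
Set Implicit Arguments.
Unset Strict Implicit.
Unset Printing Implicit Defensive.
Import Order.TTheory GRing.Theory Num.Theory.
Import numFieldNormedType.Exports.
Local Open Scope classical_set_scope.
Local Open Scope ring_scope.

(** Write [x_n], [r_n], [g_n] for the iterate, the subgradient of [Reg] selected
    by the proximal step and the mean gradient [M^-1 \sum_m grad (F m)], each
    minus its value at the critical point; let [U_n] be the family of dual errors
    divided by [M omega_m], [|U_n|^2] its [omega]-weighted squared norm and
    [a_n = \sum_m omega_m K_m^* U_n,m].  With [tau = gamma_{n+1}] the primal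
    step reads

      [x_{n+1} + tau r_{n+1} = x_n - tau (g_n + a_{n+1})],

    and monotonicity of the subdifferentials of the conjugates turns the dual
    step into a scalar inequality.  Squaring the former and adding the latter
    ([primal_dual_step]) shows, after division by [tau ^ 2], that the energy

      [E_n = (1 - 2 tau muF kappa) / tau^2 |x_n|^2 + |r_n|^2
             + (eta |U_n|^2 - |a_n|^2)]

    decreases by at least [D_n = |r_n + a_{n+1}|^2 + |g_n|^2], up to an error
    discussed below.  Three facts enter.
    - Strong monotonicity of the subdifferential of [Reg] and of the mean
      gradient improves the two weights of [|x|^2] to [(1 + 2 tau muR) / tau^2]
      after the step and [(1 - 2 tau muF kappa) / tau^2] before it.  The
      recursion of the stepsizes is precisely the identity that makes the weight
      after one step equal to the weight before the next one ([gamma_div]).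
    - The share [1 - kappa] of the monotonicity of the mean gradient pays for
      [|g_n|^2] as soon as [tau <= (1 - kappa) / L], [L] being a cocoercivity
      constant of the mean gradient.  The stepsizes tend to zero and the theorem
      asks for some constant only, so that it is enough to argue for large [n],
      and any [L] will do.
    - Either choice of the norm gives [\sum_m omega_m |K_m x|^2 <= eta |x|^2],
      hence [|a_n|^2 <= eta |U_n|^2].  So one argument, carried out with the
      averages over [m], covers both.

    The error comes from the averaging: the dual update with index [m] sees
    the increment of its own gradient, not that of the mean.  It is bounded by
    a multiple of [|x_{n+1} - x_n| |U_{n+2}|].  Since the subdifferential of
    [Reg] is monotone, [|x_{n+1} - x_n|^2 <= 2 tau^2 D_n] ([prox_step_le]), so
    Young's inequality splits the error into a part absorbed by the previous
    decrease [D_n] and a part of order [gamma_{n+1}^2] times the energies.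
    Because [1 / gamma] grows at least linearly ([gamma_inv_growth]),
    [gamma_{n+1}^2] is at most a multiple of [gamma_n - gamma_{n+1}], the growth
    factors telescope, and the energy stays bounded ([energy_bounded]).  This
    gives the estimate with a constant, and linear growth of [1 / gamma] gives
    the order [1 / k^2].

    The proximal points are limits of minimizing sequences, which are Cauchy by
    the parallelogram identity; the lower bounds come from the subgradients
    at the critical point, which also yield the quadratic growth of the
    objective ([Psi_growth]), hence that this point is the unique minimizer. *)

(** * Inner products, Riesz representatives and operator norms *)

Section InnerProduct.
Context {R : realType} {V : fdHilbertType R}.
Implicit Types x y z : V.

Lemma innerC x y : inner x y = inner y x.
Proof. by rewrite hermC /= expr0 mul1r. Qed.

Lemma innerDl x y z : inner (x + y) z = inner x z + inner y z.
Proof. exact: linearDl. Qed.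

Lemma innerDr x y z : inner x (y + z) = inner x y + inner x z.
Proof. exact: linearDr. Qed.

Lemma innerNl x y : inner (- x) y = - inner x y.
Proof. exact: linearNl. Qed.

Lemma innerNr x y : inner x (- y) = - inner x y.
Proof. exact: linearNr. Qed.

Lemma innerBl x y z : inner (x - y) z = inner x z - inner y z.
Proof. exact: linearBl. Qed.

Lemma innerBr x y z : inner x (y - z) = inner x y - inner x z.
Proof. exact: linearBr. Qed.

Lemma innerZl (c : R) x y : inner (c *: x) y = c * inner x y.
Proof. exact: linearZl_LR. Qed.

Lemma innerZr (c : R) x y : inner x (c *: y) = c * inner x y.
Proof. exact: linearZr_LR. Qed.

Lemma inner0l x : inner 0 x = 0.
Proof. exact: linear0l. Qed.

Lemma inner0r x : inner x 0 = 0.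
Proof. exact: linear0r. Qed.

Lemma inner_suml I (r : seq I) (P : pred I) (f : I -> V) x :
  inner (\sum_(i <- r | P i) f i) x = \sum_(i <- r | P i) inner (f i) x.
Proof. exact: linear_sumlz. Qed.

Definition innerE := (innerDl, innerDr, innerNl, innerNr, innerZl, innerZr).

Lemma inner_ge0 x : 0 <= inner x x.
Proof. by rewrite -inner_norm sqr_ge0. Qed.

Lemma inner_eq0 x : inner x x = 0 -> x = 0.
Proof.
by move=> h; apply/eqP; rewrite -normr_eq0 -sqrf_eq0 inner_norm h.
Qed.

(** Reduces identities between combinations of vectors to identities between
    real numbers. *)
Lemma inner_ext x y : (forall z, inner x z = inner y z) -> x = y.
Proof.
by move=> h; apply/subr0_eq/inner_eq0; rewrite innerBl h subrr.
Qed.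

Lemma inner_young (s : R) x y : 0 < s ->
  2 * inner x y <= s^-1 * `|x| ^+ 2 + s * `|y| ^+ 2.
Proof.
move=> s0; have := inner_ge0 (x - s *: y).
rewrite !inner_norm !innerE (innerC y x) => h.
rewrite -(ler_pM2l s0).
have -> : s * (s^-1 * inner x x + s * inner y y) = inner x x + s ^+ 2 * inner y y.
  by field; rewrite gt_eqF.
by nra.
Qed.

Lemma cauchy_schwarz x y : inner x y <= `|x| * `|y|.
Proof.
have [->|x0] := eqVneq x 0; first by rewrite inner0l normr0 mul0r.
have [->|y0] := eqVneq y 0; first by rewrite inner0r normr0 mulr0.
have nx : 0 < `|x| by rewrite normr_gt0.
have ny : 0 < `|y| by rewrite normr_gt0.
have := @inner_young (`|x| / `|y|) x y (divr_gt0 nx ny).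
have -> : (`|x| / `|y|)^-1 * `|x| ^+ 2 + `|x| / `|y| * `|y| ^+ 2
  = 2 * (`|x| * `|y|) by field; rewrite !gt_eqF.
by rewrite ler_pM2l.
Qed.

Lemma sqr_normD x y : `|x + y| ^+ 2 = `|x| ^+ 2 + 2 * inner x y + `|y| ^+ 2.
Proof. rewrite !inner_norm !innerE (innerC y x); ring. Qed.

Lemma sqr_normB x y : `|x - y| ^+ 2 = `|x| ^+ 2 - 2 * inner x y + `|y| ^+ 2.
Proof. by rewrite sqr_normD innerNr normrN; ring. Qed.

Lemma sqr_normZ (c : R) x : `|c *: x| ^+ 2 = c ^+ 2 * `|x| ^+ 2.
Proof. by rewrite normrZ exprMn real_normK ?num_real. Qed.

Lemma sqr_normD_le x y : `|x + y| ^+ 2 <= 2 * (`|x| ^+ 2 + `|y| ^+ 2).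
Proof. by have := sqr_ge0 `|x - y|; rewrite sqr_normD sqr_normB; lra. Qed.

End InnerProduct.

Section Riesz.
Context {R : realType} (V : fdHilbertType R).

(** The map from [V] to its dual is injective because the inner product is
    definite, hence surjective because the dimensions agree. *)
Definition inner_hom (v : V) : 'Hom(V, R^o) :=
  linfun (inner v : {linear V -> R^o}).

Lemma inner_hom_linear : linear inner_hom.
Proof.
move=> c v w; apply/lfunP => y.
by rewrite add_lfunE scale_lfunE !lfunE /= innerDl innerZl.
Qed.

HB.instance Definition _ :=
  GRing.isLinear.Build R V 'Hom(V, R^o) _ inner_hom inner_hom_linear.

Lemma rieszP (l : V -> R^o) : linear l -> forall y, l y = inner (riesz l) y.
Proof.
move=> l_lin.
suff: exists v, [set v | forall y, l y = inner v y] v by move/xgetPex; exact.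
pose l' : {linear V -> R^o} := HB.pack l (GRing.isLinear.Build _ _ _ _ l l_lin).
have inj : lker (linfun inner_hom) = 0%VS.
  apply/eqP; rewrite -subv0; apply/subvP => v.
  rewrite memv_ker lfunE /= => /eqP /lfunP /(_ v).
  by rewrite !lfunE /= => /inner_eq0 ->; rewrite mem0v.
have full : limg (linfun inner_hom) = fullv.
  apply/eqP; rewrite eqEdim subvf /= limg_dim_eq ?inj ?capv0 //.
  by rewrite !dimvf /dim /= muln1.
have := memvf (linfun l'); rewrite -full => /memv_imgP[v _ e].
by exists v => y; move/lfunP : e => /(_ y); rewrite !lfunE.
Qed.

End Riesz.

Section Operators.
Context {R : realType} {V W : fdHilbertType R}.

Lemma adjointP (K : {linear V -> W}) u x : inner (adjoint K u) x = inner (K x) u.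
Proof.
by rewrite -rieszP // => c y z; rewrite linearP innerDl innerZl.
Qed.

Lemma adjointZ (K : {linear V -> W}) (c : R) u : adjoint K (c *: u) = c *: adjoint K u.
Proof.
apply/subr0_eq/inner_eq0; set d := (_ - _).
by rewrite {1}/d innerDl innerNl innerZl !adjointP innerZr subrr.
Qed.

Lemma adjointD (K : {linear V -> W}) u v :
  adjoint K (u + v) = adjoint K u + adjoint K v.
Proof.
apply/subr0_eq/inner_eq0; set d := (_ - _).
by rewrite {1}/d innerDl innerNl innerDl !adjointP innerDr subrr.
Qed.

Lemma adjoint_linear (K : {linear V -> W}) : linear (adjoint K).
Proof. by move=> c u v; rewrite adjointD adjointZ. Qed.

HB.instance Definition _ (K : {linear V -> W}) :=
  GRing.isLinear.Build R W V _ (adjoint K) (adjoint_linear K).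

(** Expand [x] in a basis: each coordinate is a linear form, so it is the inner
    product with its Riesz representative. *)
Lemma linear_bounded (f : V -> W) : linear f ->
  exists C, forall x, `|f x| <= C * `|x|.
Proof.
move=> f_lin.
pose g : {linear V -> W} := HB.pack f (GRing.isLinear.Build _ _ _ _ f f_lin).
pose e := vbasis {:V}.
have co_lin i : linear (coord e i : V -> R^o) by move=> c y z; rewrite linearP.
exists (\sum_i `|riesz (coord e i : V -> R^o)| * `|g e`_i|) => x.
rewrite -[f x]/(g x) [X in g X](coord_vbasis (memvf x)) linear_sum mulr_suml.
apply: (le_trans (ler_norm_sum _ _ _)); apply: ler_sum => i _.
rewrite linearZ normrZ mulrAC ler_wpM2r // rieszP //.
by rewrite ler_norml cauchy_schwarz lerNl -innerNl -[`|riesz _|]normrN cauchy_schwarz.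
Qed.

(** Boundedness matters here: the supremum of an unbounded set is 0 by
    convention, which would make the inequality false. *)
Lemma opnormP (f : V -> W) : linear f -> forall x, `|f x| <= opnorm f * `|x|.
Proof.
move=> f_lin x.
pose g : {linear V -> W} := HB.pack f (GRing.isLinear.Build _ _ _ _ f f_lin).
have fZ c y : f (c *: y) = c *: f y by rewrite -[f]/(g : V -> W) linearZ.
have [C fC] := linear_bounded f_lin.
have [->|x0] := eqVneq x 0; first by rewrite -[f]/(g : V -> W) linear0 !normr0 mulr0.
have nx : 0 < `|x| by rewrite normr_gt0.
rewrite -ler_pdivrMr // mulrC -[`|x|^-1]gtr0_norm ?invr_gt0 // -normrZ -fZ.
apply: ub_le_sup.
  exists `|C| => _ [y y1 <-]; apply: (le_trans (fC y)).
  by apply: (le_trans (ler_wpM2r (normr_ge0 _) (ler_norm C))); rewrite ler_piMr.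
by exists (`|x|^-1 *: x) => //=; rewrite normrZ normfV normr_id mulVf // gt_eqF.
Qed.

End Operators.

(** * Gradients of smooth convex functions *)

Section SmoothConvex.
Context {R : realType} {V : fdHilbertType R}.
Implicit Types f : V -> R.

Lemma gradP f x d : differentiable f x -> inner (grad f x) d = 'D_d f x.
Proof.
move=> df; rewrite deriveE // /grad -rieszP // => c y z.
by rewrite linearP.
Qed.

Lemma convex_segment (h : V -> R) (x y : V) (t : R) : 0 <= t <= 1 ->
  convex_function [set: V] h -> h (t *: x + (1 - t) *: y) <= t * h x + (1 - t) * h y.
Proof.
by move=> /andP[t0 t1] /(_ (Itv01 t0 t1) x y); apply; rewrite in_setT.
Qed.

(** This identity turns strong convexity, which is convexity after subtraction
    of a quadratic, into a convexity inequality with a quadratic gain. *)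
Lemma sqr_norm_segment (x y : V) (t : R) :
  `|t *: x + (1 - t) *: y| ^+ 2 =
  t * `|x| ^+ 2 + (1 - t) * `|y| ^+ 2 - t * (1 - t) * `|x - y| ^+ 2.
Proof. by rewrite (sqr_normB x) sqr_normD !sqr_normZ !innerE; ring. Qed.

Lemma strongly_convex_segment mu f (x y : V) (t : R) : 0 <= t <= 1 ->
  convex_function [set: V] (fun z => f z - mu / 2 * `|z| ^+ 2) ->
  f (t *: x + (1 - t) *: y) + mu / 2 * (t * (1 - t)) * `|x - y| ^+ 2
    <= t * f x + (1 - t) * f y.
Proof.
move=> t01 /(convex_segment x y t01); rewrite sqr_norm_segment; lra.
Qed.

(** Divide the convexity inequality on the segment by its parameter and let the
    parameter tend to 0 from the right. *)
Lemma strongly_convex_derive mu f (x d : V) : derivable f x d ->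
  convex_function [set: V] (fun z => f z - mu / 2 * `|z| ^+ 2) ->
  f x + 'D_d f x + mu / 2 * `|d| ^+ 2 <= f (x + d).
Proof.
move=> df cf.
pose b (h : R) := f (x + d) - f x - mu / 2 * (1 - h) * `|d| ^+ 2.
have cvb : b h @[h --> 0^'+] --> b 0.
  apply: cvg_at_right_filter; rewrite /b.
  apply: cvgB; first exact: cvg_cst.
  apply: cvgMl; apply: cvgMr; apply: cvgB; [exact: cvg_cst | exact: cvg_id].
have cvq := cvg_dnbhs_at_right df.
have : 'D_d f x <= b 0.
  apply: (ler_cvg_to cvq cvb); near=> h.
  have h0 : 0 < h by near: h; exact: nbhs_right_gt.
  have h1 : h <= 1 by near: h; exact: nbhs_right_le.
  rewrite /b -[_ *: _]/(_ * _) ler_pdivrMl //=.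
  have h01 : 0 <= h <= 1 by rewrite ltW.
  have := strongly_convex_segment (x + d) x h01 cf.
  have -> : h *: (x + d) + (1 - h) *: x = h *: d + x.
    by rewrite scalerDr scalerBl scale1r [_ + h *: d]addrC -addrA subrKC.
  rewrite addrAC subrr add0r => H; lra.
rewrite /b; lra.
Unshelve. all: by end_near.
Qed.

Lemma convex_gradient_le f (x y : V) : differentiable f x ->
  convex_function [set: V] f -> f x + inner (grad f x) (y - x) <= f y.
Proof.
move=> df cf; rewrite gradP //.
have := @strongly_convex_derive 0 f x (y - x) (diff_derivable df).
rewrite !mul0r addr0 subrKC; apply.
by under eq_fun do rewrite !mul0r subr0.
Qed.

Lemma smooth_lipschitz (L : R) f (x y : V) : smooth L f ->
  `|grad f x - grad f y| <= L * `|x - y|.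
Proof. by move=> [_ /(_ (x, y))]; apply. Qed.

Lemma strong_growth_monotone (mu : R) f (g : V -> V) :
  (forall x d, f x + inner (g x) d + mu / 2 * `|d| ^+ 2 <= f (x + d)) ->
  forall x y, mu * `|x - y| ^+ 2 <= inner (x - y) (g x - g y).
Proof.
move=> growth x y; have := growth y (x - y); have := growth x (y - x).
rewrite !subrKC -(opprB x y) normrN innerNr innerBr !(innerC (x - y)).
by move: (inner (g x) _) (inner (g y) _) => i j; lra.
Qed.

(** The gradient is abstracted to any Lipschitz selection [g] of subgradients of
    [f], so that the argument runs on these two inequalities alone. *)
Section LipschitzSubgradient.
Variables (L : R) (f : V -> R) (g : V -> V).
Hypothesis L_gt0 : 0 < L.
Hypothesis g_subgradient : forall x y, f x + inner (g x) (y - x) <= f y.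
Hypothesis g_lipschitz : forall x y, `|g x - g y| <= L * `|x - y|.

(** Compare [f] at [x] and at the point reached from [y] by a gradient step of
    length [1 / (2 L)] for [f] minus its linear part at [x]. The subgradient
    inequality at that point bounds [f] there from above with the quadratic term
    [L |z - y|^2]; it replaces the descent lemma at the cost of a factor 2. *)
Lemma bregman_ge x y :
  `|g y - g x| ^+ 2 <= 4 * L * (f y - f x - inner (g x) (y - x)).
Proof.
pose d := g y - g x; pose z := y - (2 * L)^-1 *: d.
have h1 := g_subgradient x z.
have h2 := g_subgradient z y.
have h3 : inner (g z - g y) (z - y) <= L * `|z - y| ^+ 2.
  apply: (le_trans (cauchy_schwarz _ _)).
  by rewrite expr2 mulrA ler_wpM2r.
have ezy : z - y = - ((2 * L)^-1 *: d) by rewrite /z addrC addKr.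
have eyz : y - z = (2 * L)^-1 *: d by rewrite -opprB ezy opprK.
have ezx : z - x = (y - x) - (2 * L)^-1 *: d by rewrite /z addrAC.
have ed : inner (g y) d - inner (g x) d = `|d| ^+ 2.
  by rewrite -innerBl inner_norm.
rewrite {}ezy normrN sqr_normZ innerNr innerZr innerBl in h3.
rewrite {}eyz innerZr in h2; rewrite {}ezx innerBr innerZr in h1.
rewrite -/d; move: ed h1 h2 h3.
move: (inner (g x) d) (inner (g y) d) (inner (g z) d).
move: (inner _ (y - x)) (f x) (f y) (f z) (`|d| ^+ 2).
move=> e fx fy fz n a b c en h1 h2 h3.
have key : (2 * L)^-1 * n - L * ((2 * L)^-1 ^+ 2 * n) <= fy - fx - e.
  rewrite -en in h3 *; lra.
apply: le_trans (ler_wpM2l _ key); last by rewrite mulr_ge0 // ltW.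
rewrite le_eqVlt; apply/orP; left; apply/eqP; field.
by rewrite gt_eqF.
Qed.

(** The Baillon-Haddad inequality, with [2 * L] in place of the optimal [L]: add
    the lower bounds on the two Bregman distances. *)
Lemma cocoercive x y :
  `|g x - g y| ^+ 2 <= 2 * L * inner (g x - g y) (x - y).
Proof.
have := bregman_ge x y; have := bregman_ge y x.
rewrite [`|g y - _|]distrC -(opprB x y) innerNr innerBl; lra.
Qed.

End LipschitzSubgradient.

Section MeanGradient.
Variables (M : nat) (F : 'I_M -> V -> R) (muF : R).
Hypothesis F_differentiable : forall m x, differentiable (F m) x.

Lemma derive_mean x d :
  is_derive x d (fun y => M%:R^-1 * \sum_m F m y : R^o)
    (inner (M%:R^-1 *: \sum_m grad (F m) x) d).
Proof.
have -> : (fun y => M%:R^-1 * \sum_m F m y : R^o) = M%:R^-1 \*: \sum_m (F m : V -> R^o).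
  by apply/funext => y; rewrite /= fct_sumE.
rewrite innerZl inner_suml; apply: is_deriveZ; apply: is_derive_sum => m.
by rewrite gradP //; apply: derivableP; exact: diff_derivable.
Qed.

Lemma mean_strong_convexity x d :
  convex_function [set: V]
    (fun y : V => M%:R^-1 * (\sum_m F m y) - muF / 2 * `|y| ^+ 2) ->
  M%:R^-1 * (\sum_m F m x) + inner (M%:R^-1 *: \sum_m grad (F m) x) d
    + muF / 2 * `|d| ^+ 2 <= M%:R^-1 * (\sum_m F m (x + d)).
Proof.
have dF := derive_mean x d.
by move/(strongly_convex_derive (@ex_derive _ _ _ _ _ _ _ dF)); rewrite derive_val.
Qed.

End MeanGradient.

End SmoothConvex.

(** * Subdifferentials and proximal points *)

Section Subdifferential.
Context {R : realType} {V : fdHilbertType R}.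
Implicit Types (G : V -> \bar R) (x y z : V) (mu : R).

Lemma proper_real G x : proper_fun G -> (G x < +oo)%E -> exists a : R, G x = a%:E.
Proof.
move=> [/(_ x) Gx _]; case: (G x) Gx => [a _ _| //| //]; by exists a.
Qed.

Lemma subdiff_real G x g : proper_fun G -> subdiff G x g -> exists a : R, G x = a%:E.
Proof.
move=> pG sG; apply: proper_real => //.
have [_ [y yfin]] := pG; have := le_lt_trans (sG y) yfin.
by case: (G x) => [r _| |] //; rewrite ltry.
Qed.

(** Plays the part of a limit [t -> 0] in the first-order conditions below. *)
Lemma le_linear_perturbation (A B C : R) :
  (forall t, 0 < t <= 1 -> A <= B + t * C) -> A <= B.
Proof.
move=> h; apply/ler_addgt0Pr => e e0.
have C1 : 0 < `|C| + 1 by rewrite ltr_wpDl.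
pose t := Num.min 1 (e / (`|C| + 1)).
have t0 : 0 < t by rewrite lt_min ltr01 divr_gt0.
have /h/le_trans : 0 < t <= 1 by rewrite t0 ge_min lexx.
apply; rewrite lerD2l.
have : t * C <= t * (`|C| + 1).
  by rewrite ler_pM2l // (le_trans (ler_norm C)) // lerDl.
move=> /le_trans; apply; rewrite -ler_pdivlMr // /t ge_min lexx orbT //.
Qed.

Lemma segmentE x y (t : R) : t *: y + (1 - t) *: x = x + t *: (y - x).
Proof. by rewrite scalerBl scale1r scalerBr addrCA. Qed.

Lemma strongly_convex_efun_segment mu G x y (a b t : R) : 0 <= t <= 1 ->
  proper_fun G -> convex_efun (fun x => G x - (mu / 2 * `|x| ^+ 2)%:E)%E ->
  G x = a%:E -> G y = b%:E ->
  (G (x + t *: (y - x))%R <=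
    (t * b + (1 - t) * a - mu / 2 * (t * (1 - t) * `|y - x| ^+ 2))%R%:E)%E.
Proof.
move=> t01 pG cG Gx Gy.
have := cG y x t t01; rewrite /= Gx Gy segmentE -!EFinB -!EFinM -!EFinD.
have := sqr_norm_segment y x t; rewrite segmentE.
case: (G _) => [c| //|] n; last by move=> _; exact: leNye.
rewrite -EFinD !lee_fin n.
by move: (`|y| ^+ 2) (`|x| ^+ 2) (`|y - x| ^+ 2) => p q r; lra.
Qed.

(** A subgradient of a strongly convex function gains the quadratic term: compare
    [G] at [x + t (y - x)] with its affine minorant and with its convex upper
    bound, divide by [t] and let [t] tend to 0. *)
Lemma strong_subgradient_le mu G x g y : proper_fun G ->
  convex_efun (fun x => G x - (mu / 2 * `|x| ^+ 2)%:E)%E -> subdiff G x g ->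
  (G x + (inner g (y - x) + mu / 2 * `|y - x| ^+ 2)%R%:E <= G y)%E.
Proof.
move=> pG cG sG; have [a Gx] := subdiff_real pG sG.
have [Gy|] := ltP (G y) +oo%E; last by rewrite leye_eq => /eqP ->; exact: leey.
have [b Gyb] := proper_real pG Gy; rewrite Gx Gyb -EFinD lee_fin.
rewrite addrA; apply: (@le_linear_perturbation _ _ (mu / 2 * `|y - x| ^+ 2)).
move=> t /andP[t0 t1]; have t01 : 0 <= t <= 1 by rewrite ltW.
have := le_trans (sG _) (strongly_convex_efun_segment t01 pG cG Gx Gyb).
rewrite Gx -EFinD lee_fin [x + _]addrC addrK innerZr.
move: (inner _ _) (`|_| ^+ 2) => i n h.
rewrite -(ler_pM2l t0); lra.
Qed.

Lemma subdiff_strongly_monotone mu G x x' g g' : proper_fun G ->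
  convex_efun (fun x => G x - (mu / 2 * `|x| ^+ 2)%:E)%E ->
  subdiff G x g -> subdiff G x' g' ->
  mu * `|x - x'| ^+ 2 <= inner (g - g') (x - x').
Proof.
move=> pG cG sx sx'.
have := strong_subgradient_le x pG cG sx'.
have := strong_subgradient_le x' pG cG sx.
have [a ->] := subdiff_real pG sx; have [b ->] := subdiff_real pG sx'.
rewrite -!EFinD !lee_fin -(opprB x x') normrN innerNr innerBl.
move: (inner _ _) (inner _ _) (`|_| ^+ 2) => i j n; lra.
Qed.

Lemma convex_efun0 G : convex_efun G ->
  convex_efun (fun x => G x - (0 / 2 * `|x| ^+ 2)%:E)%E.
Proof. by move=> cG; under eq_fun do rewrite !mul0r sube0. Qed.

Lemma subdiff_monotone G x x' g g' : proper_fun G -> convex_efun G ->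
  subdiff G x g -> subdiff G x' g' -> 0 <= inner (g - g') (x - x').
Proof.
move=> pG /convex_efun0 cG sx sx'.
by have := subdiff_strongly_monotone pG cG sx sx'; rewrite mul0r.
Qed.

End Subdifferential.

(** A proximal point exists and satisfies the expected inclusion. The lower bound
    on the objective is provided by one known subgradient [g0] at [x0]. *)
Section Prox.
Context {R : realType} {V : fdHilbertType R}.
Variables (G : V -> \bar R) (c : R) (z x0 g0 : V).
Hypotheses (c_gt0 : 0 < c) (pG : proper_fun G) (lG : lower_semicontinuous G).
Hypotheses (cG : convex_efun G) (sG : subdiff G x0 g0).

Let Phi y := (c%:E * G y + (2^-1 * `|z - y| ^+ 2)%:E)%E.

(** The finite values of the proximal objective, as real numbers. *)
Let prox_value (y : V) (v : R) := exists2 a : R, G y = a%:E & v = c * a + 2^-1 * `|z - y| ^+ 2.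

Let PhiE y v : prox_value y v -> Phi y = v%:E.
Proof. by move=> [a Gy ->]; rewrite /Phi Gy. Qed.

Let values := [set v | exists y, prox_value y v].

Let values_inf : has_inf values.
Proof.
have [a Gx0] := subdiff_real pG sG; split.
  by exists (c * a + 2^-1 * `|z - x0| ^+ 2), x0, a.
exists (c * (a + inner g0 (z - x0)) - 2^-1 * c ^+ 2 * `|g0| ^+ 2).
move=> _ [y [b Gy ->]].
have := sG y; rewrite Gx0 Gy -EFinD lee_fin => /(ler_wpM2l (ltW c_gt0)).
have -> : y - x0 = (z - x0) - (z - y) by rewrite opprB [RHS]addrC subrKA.
have := @inner_young _ _ 1 (c *: g0) (z - y) ltr01.
rewrite innerZl sqr_normZ (innerBr g0 (z - x0)) invr1 !mul1r.
move: (inner g0 (z - x0)) (inner g0 (z - y)) (`|g0| ^+ 2) (`|z - y| ^+ 2) => i j n1 n2.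
lra.
Qed.

Let m := inf values.

Let m_le y v : prox_value y v -> m <= v.
Proof. by move=> h; apply: ge_inf; [case: values_inf | exists y]. Qed.

(** Evaluating the objective at the midpoint, where it is at least the infimum,
    bounds the distance of two points by their excess over the infimum. *)
Let midpoint y y' v v' : prox_value y v -> prox_value y' v' ->
  `|y - y'| ^+ 2 <= 4 * ((v - m) + (v' - m)).
Proof.
move=> [a Ga ->] [a' Ga' ->].
have half : 0 <= (2^-1 : R) <= 1 by lra.
have := strongly_convex_efun_segment half pG (convex_efun0 cG) Ga' Ga.
rewrite !mul0r subr0.
move=> hmid; have [b Gb] := proper_real pG (le_lt_trans hmid (ltry _)).
move: hmid; rewrite Gb lee_fin => /(ler_wpM2l (ltW c_gt0)) hb.
have := @m_le _ _ (ex_intro2 _ _ b Gb erefl).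
have -> : z - (y' + 2^-1 *: (y - y')) = 2^-1 *: (z - y) + (1 - 2^-1) *: (z - y').
  rewrite segmentE opprD addrA -scalerN; congr (_ + _ *: _).
  by rewrite !opprB [RHS]addrC subrKA.
rewrite sqr_norm_segment.
have -> : z - y - (z - y') = y' - y by rewrite opprB [LHS]addrC subrKA.
rewrite [`|y' - y|]distrC.
move: (`|z - y| ^+ 2) (`|z - y'| ^+ 2) (`|y - y'| ^+ 2) => n1 n2 n3 h.
by lra.
Qed.

Let minimizing : exists y : nat -> V, forall n,
  exists2 v, prox_value (y n) v & v - m <= harmonic n.
Proof.
suff /choice[f fP] : forall n, exists y, exists2 v, prox_value y v & v - m <= harmonic n.
  by exists f.
move=> n; have hn : 0 < (harmonic n : R) by rewrite /harmonic /= invr_gt0.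
have [v [y yv] vm] := inf_adherent hn values_inf.
by exists y, v => //; rewrite lerBlDl ltW.
Qed.

(** By [midpoint] a minimizing sequence is Cauchy; lower semicontinuity shows
    that its limit is a minimizer. *)
Lemma prox_argmin : argmin Phi (prox (fun y => c%:E * G y)%E z).
Proof.
suff: exists p, argmin Phi p by move/xgetPex; exact.
have [y hy] := minimizing.
have ycauchy : cauchy (y @ \oo).
  apply/cauchy_exP => e e0.
  have : \forall n \near \oo, 8 * harmonic n < e ^+ 2 :> R.
    have : 8 * harmonic n @[n --> \oo] --> (8 * 0 : R).
      by apply: cvgM; [exact: cvg_cst | exact: cvg_harmonic].
    by rewrite mulr0 => /cvgr_lt; apply; exact: exprn_gt0.
  move=> [N _ hN]; exists (y N); exists N => // k /= Nk.
  rewrite /= -ball_normE /ball_ /= -(ltr_pXn2r (n := 2)) ?nnegrE ?(ltW e0) //.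
  have [v yv vm] := hy N; have [v' yv' vm'] := hy k.
  apply: (le_lt_trans (midpoint yv yv')).
  apply: le_lt_trans (hN N (leqnn N)).
  have : harmonic k <= harmonic N :> R.
    by rewrite /harmonic /= lef_pV2 ?posrE // ler_nat ltnS.
  by lra.
have /cauchy_cvgP/cvg_ex[p yp] := ycauchy.
exists p => w.
have [Gw|] := ltP (G w) +oo%E; last first.
  rewrite leye_eq => /eqP Gw; rewrite /Phi Gw gt0_muley ?lte_fin //.
  by rewrite addye // leey.
have [b Gwb] := proper_real pG Gw.
have wv : prox_value w (c * b + 2^-1 * `|z - w| ^+ 2) by exists b.
apply: le_trans (_ : (m%:E <= _)%E); last first.
  by rewrite (PhiE wv) lee_fin; exact: m_le wv.
rewrite leNgt; apply/negP => mPhi.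
pose r := (m - 2^-1 * `|z - p| ^+ 2) / c.
have [s rs sG'] : exists2 s : R, r < s & (s%:E < G p)%E.
  move: mPhi; rewrite /Phi; case: (G p) => [a||].
  - rewrite -EFinM -EFinD lte_fin => h.
    have ra : r < a by rewrite /r ltr_pdivrMr // mulrC; lra.
    by exists ((r + a) / 2); rewrite ?lte_fin; lra.
  - by move=> _; exists (r + 1); rewrite ?ltry //; lra.
  - by rewrite gt0_muleNy ?lte_fin.
have [A pA sA] := lG sG'.
have cvl : c * s + 2^-1 * `|z - y n| ^+ 2 @[n --> \oo] --> (c * s + 2^-1 * `|z - p| ^+ 2 : R).
  apply: cvgD; first exact: cvg_cst.
  apply: cvgMr; apply: cvgM; apply: cvg_norm; apply: cvgB => //; exact: cvg_cst.
have cvr : m + harmonic n @[n --> \oo] --> (m + 0 : R).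
  by apply: cvgD; [exact: cvg_cst|exact: cvg_harmonic].
have : c * s + 2^-1 * `|z - p| ^+ 2 <= m + 0.
  apply: (ler_cvg_to cvl cvr); near=> n.
  have [v [a Gy ->] vm] := hy n.
  have : (s%:E < G (y n))%E by apply: sA; near: n; exact: yp.
  rewrite Gy lte_fin => /ltW /(ler_wpM2l (ltW c_gt0)); lra.
move: rs; rewrite /r ltr_pdivrMr // mulrC; lra.
Unshelve. all: by end_near.
Qed.

(** First-order condition: compare the minimal value with the value at
    [p + t (w - p)], divide by [t] and let [t] tend to 0. *)
Lemma prox_subdiff (p := prox (fun y => c%:E * G y)%E z) :
  subdiff G p (c^-1 *: (z - p)).
Proof.
have := prox_argmin; rewrite -/p => hp.
have [a Gx0] := subdiff_real pG sG.
have [b Gp] : exists b, G p = b%:E.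
  apply: proper_real => //; have := hp x0; rewrite /Phi Gx0 -EFinM -EFinD.
  by case: (G p) => [r _||] //; rewrite ?ltry // gt0_muley ?lte_fin.
move=> w; have [Gw|] := ltP (G w) +oo%E; last first.
  by rewrite leye_eq => /eqP ->; exact: leey.
have [d Gwd] := proper_real pG Gw; rewrite Gp Gwd -EFinD lee_fin innerZl.
apply: (@le_linear_perturbation _ _ _ ((2 * c)^-1 * `|w - p| ^+ 2)) => t /andP[t0 t1].
have t01 : 0 <= t <= 1 by rewrite ltW.
have hseg := strongly_convex_efun_segment t01 pG (convex_efun0 cG) Gp Gwd.
have [e Ge] := proper_real pG (le_lt_trans hseg (ltry _)).
move: hseg; rewrite Ge lee_fin !mul0r subr0 => /(ler_wpM2l (ltW c_gt0)) he.
have := hp (p + t *: (w - p)); rewrite /Phi Ge Gp -!EFinM -!EFinD lee_fin.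
rewrite opprD addrA (sqr_normB (z - p)) sqr_normZ innerZr.
move: (inner (z - p) (w - p)) (`|z - p| ^+ 2) (`|w - p| ^+ 2) => i n1 n2 h.
rewrite -(ler_pM2l c_gt0) -(ler_pM2l t0).
have -> : t * (c * (d + t * ((2 * c)^-1 * n2))) = t * (c * d) + 2^-1 * t ^+ 2 * n2.
  by field; rewrite gt_eqF.
have -> : t * (c * (b + c^-1 * i)) = t * (c * b) + t * i by field; rewrite gt_eqF.
lra.
Qed.

End Prox.

(** * Conjugates and the minimizer of the objective *)

Section Conjugate.
Context {R : realType} {V : fdHilbertType R}.
Implicit Types (G : V -> \bar R) (u v w x g : V).

Lemma fenchel_young G u v : ((inner u v)%:E - G v <= conjugate G u)%E.
Proof. by apply: ereal_sup_ubound; exists v. Qed.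

Lemma conjugate_subdiff G x g (a : R) : G x = a%:E -> subdiff G x g ->
  conjugate G g = (inner g x - a)%:E.
Proof.
move=> Gx sG; apply/eqP; rewrite eq_le; apply/andP; split; last first.
  by have := fenchel_young G g x; rewrite Gx.
apply: ge_ereal_sup => _ [v _ <-].
have := sG v; rewrite Gx innerBr; case: (G v) => [b| _|//]; last exact: leNye.
by rewrite -EFinD lee_fin -EFinB lee_fin; lra.
Qed.

(** Half of the Fenchel duality between the subdifferentials of [G] and of its
    conjugate: the Fenchel-Young inequality is an equality at a subgradient. *)
Lemma subdiff_conjugate G x g (a : R) : G x = a%:E -> subdiff G x g ->
  subdiff (conjugate G) g x.
Proof.
move=> Gx sG w; rewrite (conjugate_subdiff Gx sG) -EFinD.
have := fenchel_young G w x; rewrite Gx -EFinB; apply: le_trans.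
rewrite lee_fin innerBr (innerC x w) (innerC x g); lra.
Qed.

Lemma conjugate_proper G x g (a : R) : G x = a%:E -> subdiff G x g ->
  proper_fun (conjugate G).
Proof.
move=> Gx sG; split.
  move=> w; apply: lt_le_trans (fenchel_young G w x).
  by rewrite Gx -EFinB ltNyr.
by exists g; rewrite (conjugate_subdiff Gx sG) ltry.
Qed.

Lemma conjugate_convex G : proper_fun G -> convex_efun (conjugate G).
Proof.
move=> pG x y t /andP[t0 t1]; apply: ge_ereal_sup => _ [v _ <-].
have t0' : (0 <= t%:E)%E by rewrite lee_fin.
have t1' : (0 <= (1 - t)%:E)%E by rewrite lee_fin subr_ge0.
case Gv : (G v) => [a| |]; last 2 first.
- by rewrite leNye.
- by have [/(_ v)] := pG; rewrite Gv.
have hx := fenchel_young G x v; have hy := fenchel_young G y v.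
rewrite Gv -EFinB in hx hy.
apply: le_trans (leeD (lee_wpmul2l t0' hx) (lee_wpmul2l t1' hy)).
rewrite -!EFinM -!EFinD lee_fin innerDl !innerZl.
by move: (inner x v) (inner y v) => i j; lra.
Qed.

(** The conjugate is a supremum of continuous affine functions. *)
Lemma conjugate_lsc G : proper_fun G -> lower_semicontinuous (conjugate G).
Proof.
move=> pG x a /ereal_sup_gt[_ [v _ <-]].
case Gv : (G v) => [b| |]; last 2 first.
- by [].
- by have [/(_ v)] := pG; rewrite Gv.
rewrite -EFinB lte_fin => ab.
pose e := (inner x v - b - a) / (`|v| + 1).
have v1 : 0 < `|v| + 1 by rewrite ltr_wpDl.
have e0 : 0 < e by rewrite divr_gt0 // subr_gt0.
exists (ball x e); first exact: nbhsx_ballx.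
move=> y; rewrite -ball_normE /ball_ /= => xy.
apply: lt_le_trans (fenchel_young G y v); rewrite Gv -EFinB lte_fin.
have : inner (x - y) v < inner x v - b - a.
  apply: (le_lt_trans (cauchy_schwarz _ _)).
  apply: (@le_lt_trans _ _ (`|x - y| * (`|v| + 1))); first by rewrite ler_wpM2l // lerDl.
  by rewrite -ltr_pdivlMr.
rewrite innerBl; lra.
Qed.

End Conjugate.

Section Minimizer.
Context {R : realType} {X : fdHilbertType R} {M : nat}.
Context {U : 'I_M -> fdHilbertType R}.
Variables (F : 'I_M -> X -> R) (H : forall m, U m -> \bar R).
Variables (K : forall m, {linear X -> U m}) (Reg : X -> \bar R).
Variables (gF : 'I_M -> X -> X) (muF muR : R) (xs : X).
Variables (h : forall m, U m) (r : X).
Hypothesis pH : forall m, proper_fun (@H m).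
Hypothesis pReg : proper_fun Reg.
Hypothesis cReg : convex_efun (fun x : X => (Reg x - (muR / 2 * `|x| ^+ 2)%:E)%E).
Hypothesis sF : forall x d, 
  M%:R^-1 * (\sum_m F m x) + inner (M%:R^-1 *: \sum_m gF m x) d + muF / 2 * `|d| ^+ 2
   <= M%:R^-1 * (\sum_m F m (x + d)).
Hypothesis sH : forall m, subdiff (@H m) (K m xs) (h m).
Hypothesis sReg : subdiff Reg xs r.
Hypothesis critical0 : 
  0 = M%:R^-1 *: (\sum_m (gF m xs + adjoint (K m) (h m))) + r.

(** The subgradients in the optimality condition add up to 0, so that the sum of
    the strong subgradient inequalities leaves only the quadratic terms. *)
Lemma Psi_growth : exists2 v : R, Psi F H K Reg xs = v%:E &
  forall y, ((v + (muF + muR) / 2 * `|y - xs| ^+ 2)%:E <= Psi F H K Reg y)%E.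
Proof.
have [b Rb] := subdiff_real pReg sReg.
have /choice[a Ha] : forall m, exists a : R, H (K m xs) = a%:E.
  by move=> m; have [a Ha] := subdiff_real (@pH m) (@sH m); exists a.
exists (M%:R^-1 * (\sum_m (F m xs + a m)) + b).
  rewrite /Psi Rb; under eq_bigr do rewrite Ha -EFinD.
  by rewrite sumEFin -EFinM -EFinD.
move=> y.
have hReg := strong_subgradient_le y pReg cReg sReg.
have hH m := @sH m (K m y).
have M_ge0 : (0 <= (M%:R^-1 : R)%:E)%E by rewrite lee_fin invr_ge0.
have hF : ((\sum_m (F m y + (a m + inner (h m) (K m y - K m xs))))%:E <=
    \sum_m ((F m y)%:E + H (K m y)))%E.
  rewrite -sumEFin; apply: lee_sum => m _.
  by rewrite EFinD leeD2l // EFinD -Ha.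
apply: le_trans (leeD (lee_wpmul2l M_ge0 hF) hReg).
rewrite Rb -EFinM -!EFinD lee_fin.
have := sF xs (y - xs); rewrite subrKC.
have e1 : inner (M%:R^-1 *: \sum_m gF m xs) (y - xs) +
    M%:R^-1 * (\sum_m inner (h m) (K m y - K m xs)) + inner r (y - xs) = 0.
  rewrite -[RHS](inner0l (y - xs)) [X in _ = inner X _]critical0 innerDl; congr (_ + _).
  rewrite big_split /= scalerDr innerDl; congr (_ + _).
  rewrite innerZl inner_suml; congr (_ * _); apply: eq_bigr => m _.
  by rewrite adjointP innerC (raddfB (K m)).
move: e1; rewrite !big_split /= !mulrDr.
move: (inner _ _) (inner _ _) (`|_| ^+ 2) => i j n; lra.
Qed.

End Minimizer.

(** * Stepsizes *)

Section Stepsizes.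
Context {R : realType}.
Implicit Types (rho sigma g : R).

(** The update formula picks the positive root of a quadratic equation. *)
Lemma stepsize_quadratic rho sigma g (g' : R) : 0 < g -> 0 <= rho -> 0 <= sigma ->
  g' = (- (g ^+ 2 * rho) + g * Num.sqrt ((g * rho) ^+ 2 + 1 + 2 * g * sigma))
       / (1 + 2 * g * sigma) ->
  0 < g' /\ (1 + 2 * g * sigma) * g' ^+ 2 + 2 * g ^+ 2 * rho * g' = g ^+ 2.
Proof.
move=> g0 r0 s0 ->; set d := 1 + 2 * g * sigma.
have d0 : 0 < d by rewrite ltr_pwDl // !mulr_ge0 // ltW.
rewrite -addrA -/d; set s := Num.sqrt _.
have gr0 : 0 <= g * rho by rewrite mulr_ge0 // ltW.
have s2 : s ^+ 2 = (g * rho) ^+ 2 + d by rewrite sqr_sqrtr // addr_ge0 ?sqr_ge0 // ltW.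
have gs : g * rho < s.
  rewrite -(ltr_pXn2r (n := 2)) ?nnegrE ?sqrtr_ge0 // s2 ltrDl //.
split.
  apply: divr_gt0 => //.
  by rewrite expr2 -mulrA -mulrN -mulrDr mulr_gt0 // addrC subr_gt0.
have -> : d * ((- (g ^+ 2 * rho) + g * s) / d) ^+ 2 +
    2 * g ^+ 2 * rho * ((- (g ^+ 2 * rho) + g * s) / d)
   = (g ^+ 2 * s ^+ 2 - g ^+ 2 * (g * rho) ^+ 2) / d.
  by field; rewrite gt_eqF.
by rewrite s2; field; rewrite gt_eqF.
Qed.

Variables (rho sigma : R) (gamma : nat -> R).
Hypotheses (rho_ge0 : 0 <= rho) (sigma_ge0 : 0 <= sigma).
Hypothesis rate_gt0 : 0 < rho + sigma.
Hypothesis gamma_gt0 : forall k, (1 <= k)%N -> 0 < gamma k.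
Hypothesis gamma_rec : forall k, (1 <= k)%N ->
  (1 + 2 * gamma k * sigma) * gamma k.+1 ^+ 2
    + 2 * gamma k ^+ 2 * rho * gamma k.+1 = gamma k ^+ 2.

(** The reason for the stepsize rule: the weight of [|x|^2] after a step with
    [gamma k] is its weight before a step with [gamma k.+1]. *)
Lemma gamma_div k : (1 <= k)%N ->
  (1 - 2 * gamma k.+1 * rho) / gamma k.+1 ^+ 2
  = (1 + 2 * gamma k * sigma) / gamma k ^+ 2.
Proof.
move=> k1; have g0 := gamma_gt0 k1; have g'0 : 0 < gamma k.+1 by exact: gamma_gt0.
apply/eqP; rewrite eqr_div ?expf_neq0 ?lt0r_neq0 //; apply/eqP.
by rewrite mulrBl mul1r -{1}gamma_rec //; ring.
Qed.

Lemma gamma_decr k : (1 <= k)%N -> gamma k.+1 <= gamma k.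
Proof.
move=> k1; have g0 := gamma_gt0 k1; have g'0 : 0 < gamma k.+1 by exact: gamma_gt0.
rewrite -(ler_pXn2r (n := 2)) ?nnegrE ?(ltW g0) ?(ltW g'0) //.
rewrite -[leRHS]gamma_rec // mulrDl mul1r -addrA lerDl.
by rewrite addr_ge0 // !mulr_ge0 ?sqr_ge0 // ltW.
Qed.

Lemma gamma_nonincreasing j k : (1 <= j)%N -> (j <= k)%N -> gamma k <= gamma j.
Proof.
move=> j1; elim: k => [|k IH]; first by rewrite leqn0 => /eqP ->.
rewrite leq_eqVlt => /orP[/eqP -> //|]; rewrite ltnS => jk.
by apply: le_trans (IH jk); apply: gamma_decr; exact: leq_trans jk.
Qed.

(** With [b = 1 / gamma k] and [b' = 1 / gamma k.+1], [gamma_div] says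
    [b'^2 - 2 rho b' = b^2 + 2 sigma b]. As [b <= b'], this gives
    [b'^2 >= b^2 + 2 (rho + sigma) b], so [b'] exceeds [b] by a fixed amount. *)
Lemma gamma_inv_growth : exists2 delta, 0 < delta &
  [/\ delta <= (gamma 1)^-1 &
      forall k, (1 <= k)%N -> (gamma k)^-1 + delta <= (gamma k.+1)^-1].
Proof.
have g1 : 0 < gamma 1 by exact: gamma_gt0.
pose c := rho + sigma.
have b1 : 0 < (gamma 1)^-1 by rewrite invr_gt0.
exists (Num.min (c / 2) (gamma 1)^-1); first by rewrite lt_min divr_gt0.
set delta := Num.min _ _.
have d0 : 0 < delta by rewrite lt_min divr_gt0.
have dc : delta <= c / 2 by rewrite ge_min lexx.
have db : delta <= (gamma 1)^-1 by rewrite ge_min lexx orbT.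
split=> // k k1.
have g0 := gamma_gt0 k1; have g'0 : 0 < gamma k.+1 by exact: gamma_gt0.
have b'b : (gamma k)^-1 <= (gamma k.+1)^-1 by rewrite lef_pV2 ?posrE // gamma_decr.
have bd : delta <= (gamma k)^-1.
  by apply: (le_trans db); rewrite lef_pV2 ?posrE // gamma_nonincreasing.
have : (gamma k.+1)^-1 ^+ 2 - 2 * rho * (gamma k.+1)^-1
     = (gamma k)^-1 ^+ 2 + 2 * sigma * (gamma k)^-1.
  have := gamma_div k1.
  have -> : (1 - 2 * gamma k.+1 * rho) / gamma k.+1 ^+ 2
    = (gamma k.+1)^-1 ^+ 2 - 2 * rho * (gamma k.+1)^-1 by field; rewrite gt_eqF.
  by move=> ->; field; rewrite gt_eqF.
have : 0 < (gamma k)^-1 by rewrite invr_gt0.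
move: (gamma k)^-1 (gamma k.+1)^-1 bd b'b => b b' bd b'b b0 e.
rewrite leNgt; apply/negP => lt.
rewrite /c in dc.
have h1 : 2 * rho * b <= 2 * rho * b' by rewrite ler_wpM2l // mulr_ge0.
have h2 : delta * delta <= (rho + sigma) / 2 * b by rewrite ler_pM // ltW.
have h3 : delta * b <= (rho + sigma) / 2 * b by rewrite ler_wpM2r // ltW.
have h4 : b' * b' < (b + delta) * (b + delta).
  by rewrite ltr_pM // (le_trans (ltW b0)).
have h5 : 0 < (rho + sigma) * b by rewrite mulr_gt0.
nra.
Qed.

Lemma gamma_le_inv delta k : 0 < delta -> delta <= (gamma 1)^-1 ->
  (forall k, (1 <= k)%N -> (gamma k)^-1 + delta <= (gamma k.+1)^-1) ->
  (1 <= k)%N -> gamma k <= (delta * k%:R)^-1.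
Proof.
move=> d0 d1 hd k1.
have h : delta * k%:R <= (gamma k)^-1.
  elim: k k1 => // -[|k] IH _; first by rewrite mulr1.
  apply: le_trans (hd _ _) => //.
  by rewrite -[k.+2]addn1 natrD mulrDr mulr1 lerD2r IH.
rewrite -[leLHS]invrK lef_pV2 // posrE ?invr_gt0 ?gamma_gt0 //.
by rewrite mulr_gt0 // ltr0n.
Qed.

(** The squares of the stepsizes are summable in telescoping form. *)
Lemma gamma_telescope delta k : 0 < delta ->
  (forall k, (1 <= k)%N -> (gamma k)^-1 + delta <= (gamma k.+1)^-1) ->
  (1 <= k)%N -> gamma k.+1 ^+ 2 <= (gamma k - gamma k.+1) / delta.
Proof.
move=> d0 hd k1.
have g0 := gamma_gt0 k1; have g'0 : 0 < gamma k.+1 by exact: gamma_gt0.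
rewrite ler_pdivlMr //.
have : (gamma k * gamma k.+1) * ((gamma k)^-1 + delta)
    <= (gamma k * gamma k.+1) * (gamma k.+1)^-1.
  by rewrite ler_wpM2l ?hd // mulr_ge0 // ltW.
rewrite mulrDr mulrAC divff ?gt_eqF // mul1r mulfK ?gt_eqF // -lerBrDl.
apply: le_trans; rewrite ler_wpM2r //; first exact: ltW.
by rewrite expr2 ler_wpM2r ?gamma_decr // ltW.
Qed.

Lemma gamma_small e : 0 < e -> exists N, forall k, (N <= k)%N -> gamma k <= e.
Proof.
move=> e0; have [delta d0 [d1 hd]] := gamma_inv_growth.
exists (Num.bound ((delta * e)^-1)).+1 => k Nk.
have k1 : (1 <= k)%N by exact: leq_trans Nk.
apply: (le_trans (gamma_le_inv d0 d1 hd k1)).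
have k0 : 0 < k%:R :> R by rewrite ltr0n.
rewrite -[leRHS]invrK lef_pV2 ?posrE ?invr_gt0 ?mulr_gt0 //.
rewrite -ler_pdivrMl // -invfM.
apply: le_trans (_ : (Num.bound ((delta * e)^-1))%:R <= _); last first.
  by rewrite ler_nat ltnW.
by apply: ltW; apply: archi_boundP; rewrite invr_ge0 mulr_ge0 // ltW.
Qed.

Lemma gamma_slack k : (2 <= k)%N ->
  0 < 1 - 2 * gamma 2 * rho <= 1 - 2 * gamma k * rho.
Proof.
move=> k2; apply/andP; split.
  have g2 : 0 < gamma 2 by exact: gamma_gt0.
  have g1 : 0 < gamma 1 by exact: gamma_gt0.
  have := @gamma_div 1 isT.
  move/(congr1 (fun z => z * gamma 2 ^+ 2)); rewrite mulfVK ?sqrf_eq0 ?gt_eqF // => ->.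
  rewrite mulr_gt0 ?exprn_gt0 // divr_gt0 ?exprn_gt0 //.
  by rewrite ltr_pwDl // !mulr_ge0 // ltW.
rewrite lerD2l lerN2 ler_wpM2r // ler_wpM2l // gamma_nonincreasing //.
Qed.

End Stepsizes.

Section PerturbedDescent.
Context {R : realType}.

(** [expR (g n) * W n] is nonincreasing, since [1 + t <= expR t]. *)
Lemma bounded_of_telescoping_growth (W g : nat -> R) (N : nat) :
  (forall n, (N <= n)%N -> 0 <= W n) -> (forall n, (N <= n)%N -> 0 <= g n) ->
  (forall n, (N <= n)%N -> W n.+1 <= (1 + (g n - g n.+1)) * W n) ->
  forall n, (N <= n)%N -> W n <= expR (g N) * W N.
Proof.
move=> W0 g0 hW.
have h n : (N <= n)%N -> expR (g n) * W n <= expR (g N) * W N.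
  elim: n => [|n IH]; first by rewrite leqn0 => /eqP <-.
  rewrite leq_eqVlt => /orP[/eqP -> //|]; rewrite ltnS => Nn.
  apply: le_trans (IH Nn).
  have -> : g n = g n.+1 + (g n - g n.+1) by rewrite subrKC.
  rewrite expRD -mulrA ler_pM2l ?expR_gt0 //.
  apply: (le_trans (hW n Nn)).
  by rewrite ler_wpM2r ?W0 // expR_ge1Dx.
move=> n Nn; apply: le_trans (h n Nn).
rewrite ler_peMl ?W0 // -expR0 ler_expR g0 //.
Qed.

End PerturbedDescent.

(** * One step of the iteration *)

Section OneStep.
Context {R : realType} {V : fdHilbertType R}.
Implicit Types (x y r g a d : V).

(** Here [p], [p'] and [s] stand for [|U|^2], [|U'|^2] and the inner product of
    the dual errors [U], [U'], while [a], [a'] are their images in the primal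
    space and [eps] is the error caused by averaging. The proof squares the primal
    identity and adds [2 tau] times the dual inequality; [|a - a'|^2] is then
    dominated by the [eta]-weighted dual increment. *)
Lemma primal_dual_step (tau eta p p' s eps : R) (x x' r r' g a a' : V) :
  0 < tau ->
  x' + tau *: r' = x - tau *: (g + a') ->
  0 <= inner (x - tau *: (r + a + g)) a' + tau * (eta * (s - p')) - tau * eps ->
  `|a - a'| ^+ 2 <= eta * (p - 2 * s + p') ->
  `|x'| ^+ 2 + 2 * tau * inner x' r'
      + tau ^+ 2 * (`|r'| ^+ 2 + (eta * p' - `|a'| ^+ 2) + `|r + a'| ^+ 2)
  <= `|x| ^+ 2 - 2 * tau * inner x g
      + tau ^+ 2 * (`|g| ^+ 2 + `|r| ^+ 2 + (eta * p - `|a| ^+ 2) - 2 * eps).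
Proof.
move=> tau0 e h2 h3.
have {}e : `|x' + tau *: r'| ^+ 2 = `|x - tau *: (g + a')| ^+ 2 by rewrite e.
have {}h2 : 0 <= 2 * tau *
    (inner (x - tau *: (r + a + g)) a' + tau * (eta * (s - p')) - tau * eps).
  by rewrite mulr_ge0 // mulr_ge0 // ltW.
have {}h3 := ler_wpM2l (sqr_ge0 tau) h3.
move: e h2 h3.
rewrite (sqr_normD x') (sqr_normB x) (sqr_normB a) (sqr_normD r) !sqr_normZ (sqr_normD g).
rewrite (innerZr _ x') (innerZr _ x) (innerDr x) (innerBl x) (innerZl _ (r + a + g)).
rewrite (innerDl (r + a)) (innerDl r).
move: (inner x' r') (inner x g) (inner x a') (inner g a') (inner r a') (inner a a').
move: (`|x'| ^+ 2) (`|r'| ^+ 2) (`|a'| ^+ 2) (`|x| ^+ 2) (`|g| ^+ 2) (`|r| ^+ 2) (`|a| ^+ 2).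
move=> nx' nr' na' nx ng nr na x'r' xg xa' ga' ra' aa'.
lra.
Qed.

(** The proximal map is nonexpansive: [x'] and [x] are the proximal points, with
    parameter [tau], of [x' + tau r'] and [x + tau r], and these differ
    by [tau (r + a' + g)]. *)
Lemma prox_step_le (tau : R) (x x' r r' g a' : V) : 0 < tau ->
  x' + tau *: r' = x - tau *: (g + a') ->
  0 <= inner (r' - r) (x' - x) ->
  `|x' - x| ^+ 2 <= tau ^+ 2 * `|(r + a') + g| ^+ 2.
Proof.
move=> tau0 e mono.
have {e}e : (x' - x) + tau *: (r' - r) = - (tau *: (r + a' + g)).
  have -> : x' = - (tau *: (g + a')) - tau *: r' + x.
    by rewrite addrC addrA -e addrK.
  rewrite addrK scalerBr addrA subrK -opprD -scalerDr; congr (- (_ *: _)).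
  by rewrite addrC addrA addrAC.
have := inner_young (- (x' - x)) (tau *: (r + a' + g)) ltr01.
have : inner (x' - x) (x' - x + tau *: (r' - r)) >= `|x' - x| ^+ 2.
  rewrite innerDr -inner_norm lerDl innerZr innerC mulr_ge0 //; exact: ltW.
rewrite e innerNr innerNl normrN sqr_normZ invr1 !mul1r.
lra.
Qed.

End OneStep.

(** * Boundedness of the energy *)

(** The recursion satisfied by the errors, with the dual families reduced to
    their primal images [a], their squared norms [p], the inner products [s] of
    consecutive members and the errors [eps]. *)
Section Descent.
Context {R : realType} {V : fdHilbertType R}.
Variables (muF muR kappa L Ce eta : R) (gamma : nat -> R).
Variables (x r g a : nat -> V) (p s eps : nat -> R).
Hypotheses (muF_ge0 : 0 <= muF) (muR_ge0 : 0 <= muR) (mu_gt0 : 0 < muF + muR).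
Hypotheses (kappa_gt0 : 0 < kappa) (kappa_lt1 : kappa < 1).
Hypotheses (L_gt0 : 0 < L) (Ce_gt0 : 0 < Ce) (eta_gt0 : 0 < eta).
Hypothesis gamma_gt0 : forall k, (1 <= k)%N -> 0 < gamma k.
Hypothesis gamma_rec : forall k, (1 <= k)%N ->
  (1 + 2 * gamma k * muR) * gamma k.+1 ^+ 2
    + 2 * gamma k ^+ 2 * (muF * kappa) * gamma k.+1 = gamma k ^+ 2.

Hypothesis primal_step : forall n,
  x n.+1 + gamma n.+1 *: r n.+1 = x n - gamma n.+1 *: (g n + a n.+1).
Hypothesis dual_step : forall n,
  0 <= inner (x n.+1 - gamma n.+2 *: (r n.+1 + a n.+1 + g n.+1)) (a n.+2)
       + gamma n.+2 * (eta * (s n.+1 - p n.+2)) - gamma n.+2 * eps n.+1.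
Hypothesis dual_diff : forall n,
  `|a n - a n.+1| ^+ 2 <= eta * (p n - 2 * s n + p n.+1).
Hypothesis dual_norm : forall n, `|a n| ^+ 2 <= eta * p n.
Hypothesis eps_le : forall n t, 0 < t ->
  - (2 * eps n.+1) <= t^-1 * (Ce * `|x n.+1 - x n| ^+ 2) + t * p n.+2.
Hypothesis r_monotone : forall n, 0 <= inner (r n.+1 - r n) (x n.+1 - x n).
Hypothesis r_strong : forall n, muR * `|x n| ^+ 2 <= inner (x n) (r n).
Hypothesis g_strong : forall n, muF * `|x n| ^+ 2 <= inner (x n) (g n).
Hypothesis g_cocoercive : forall n, `|g n| ^+ 2 <= L * inner (x n) (g n).

Let rho := muF * kappa.

Let rho_ge0 : 0 <= rho. Proof. by rewrite mulr_ge0 // ltW. Qed.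

Let rate_gt0 : 0 < rho + muR.
Proof.
have [m0|m0] := ltP 0 muR; first by rewrite ltr_wpDl.
have m1 : 0 < muF by apply: (lt_le_trans mu_gt0); rewrite gerDl.
by rewrite /rho ltr_pwDl // mulr_gt0.
Qed.

Let energy n := (1 - 2 * gamma n.+1 * rho) / gamma n.+1 ^+ 2 * `|x n| ^+ 2
  + `|r n| ^+ 2 + (eta * p n - `|a n| ^+ 2).

(** The amount by which the energy decreases from [n] to [n.+1], apart from the
    error [eps n]. *)
Let drop n := `|r n + a n.+1| ^+ 2 + `|g n| ^+ 2.

(** Adding the last decrease to the energy lets it absorb the next error. *)
Let W n := energy n.+1 + drop n.

Let drop_ge0 n : 0 <= drop n.
Proof. by rewrite addr_ge0 // sqr_ge0. Qed.

Let weight_ge0 n :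
  0 <= (1 - 2 * gamma n.+2 * rho) / gamma n.+2 ^+ 2.
Proof.
rewrite (gamma_div gamma_gt0 gamma_rec) // divr_ge0 ?sqr_ge0 //.
have := gamma_gt0 (ltn0Sn n); move=> /ltW g0.
by rewrite addr_ge0 // !mulr_ge0.
Qed.

Let energy_ge n :
  (1 - 2 * gamma n.+2 * rho) / gamma n.+2 ^+ 2 * `|x n.+1| ^+ 2 <= energy n.+1.
Proof.
by rewrite /energy -addrA lerDl addr_ge0 ?sqr_ge0 // subr_ge0.
Qed.

Let r_le_energy n : `|r n.+1| ^+ 2 <= energy n.+1.
Proof.
rewrite /energy -addrA addrCA lerDl addr_ge0 ?subr_ge0 //.
by rewrite mulr_ge0 ?weight_ge0 ?sqr_ge0.
Qed.

Let dual_le_energy n : eta * p n.+1 <= energy n.+1 + `|a n.+1| ^+ 2.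
Proof.
rewrite /energy -[leLHS]add0r -addrA subrK lerD2r.
by rewrite addr_ge0 ?sqr_ge0 // mulr_ge0 ?weight_ge0 ?sqr_ge0.
Qed.

(** The monotonicity of [g] is split into the share [kappa], which gives the
    contraction through [muF], and the share [1 - kappa], which through
    cocoercivity pays twice [|g|^2]: once for the square in [primal_dual_step]
    and once for its occurrence in [drop]. *)
Let energy_descent n : gamma n.+2 <= (1 - kappa) / L ->
  energy n.+2 + drop n.+1 <= energy n.+1 - 2 * eps n.+1.
Proof.
move=> small.
have t0 : 0 < gamma n.+2 by exact: gamma_gt0.
have := primal_dual_step t0 (primal_step n.+1) (dual_step n) (dual_diff n.+1).
rewrite /energy /drop (gamma_div gamma_gt0 gamma_rec) //.
have h1 := r_strong n.+2; have h2 := g_strong n.+1; have h3 := g_cocoercive n.+1.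
move: t0 small h1 h2 h3.
move: (gamma n.+2) (inner (x n.+2) (r n.+2)) (inner (x n.+1) (g n.+1)).
move: (`|x n.+2| ^+ 2) (`|r n.+2| ^+ 2) (`|a n.+2| ^+ 2) (`|r n.+1 + a n.+2| ^+ 2).
move: (`|x n.+1| ^+ 2) (`|r n.+1| ^+ 2) (`|a n.+1| ^+ 2) (sqr_ge0 `|g n.+1|).
move: (`|g n.+1| ^+ 2) (p n.+1) (p n.+2) (eps n.+1).
move=> ng q q' e nx nr na ng0 nx' nr' na' nra' t xr xg t0 small h1 h2 h3 h.
have {}h1 : 2 * t * (muR * nx') <= 2 * t * xr by rewrite ler_wpM2l // mulr_ge0 // ltW.
have {}h2 : 2 * t * kappa * (muF * nx) <= 2 * t * kappa * xg.
  by rewrite ler_wpM2l // !mulr_ge0 // ltW.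
have {}h3 : 2 * t ^+ 2 * ng <= 2 * t * (1 - kappa) * xg.
  have -> : 2 * t ^+ 2 * ng = 2 * t * (t * ng) by ring.
  rewrite -[leRHS]mulrA ler_wpM2l ?mulr_ge0 ?(ltW t0) //.
  apply: (le_trans (ler_wpM2r ng0 small)).
  rewrite mulrAC -mulrA ler_wpM2l ?subr_ge0 ?(ltW kappa_lt1) //.
  by rewrite ler_pdivrMr // mulrC.
have key : (1 + 2 * t * muR) * nx' + t ^+ 2 * (nr' + (eta * q' - na') + nra' + ng)
    <= (1 - 2 * t * rho) * nx + t ^+ 2 * (nr + (eta * q - na) - 2 * e).
  rewrite /rho; lra.
rewrite -(ler_pM2l (exprn_gt0 2 t0)).
rewrite -subr_ge0.
have -> : t ^+ 2 * ((1 - 2 * t * rho) / t ^+ 2 * nx + nr + (eta * q - na) - 2 * e)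
   - t ^+ 2 * ((1 + 2 * t * muR) / t ^+ 2 * nx' + nr' + (eta * q' - na') + (nra' + ng))
  = ((1 - 2 * t * rho) * nx + t ^+ 2 * (nr + (eta * q - na) - 2 * e)) -
    ((1 + 2 * t * muR) * nx' + t ^+ 2 * (nr' + (eta * q' - na') + nra' + ng)).
  by field; rewrite gt_eqF.
by rewrite subr_ge0.
Qed.

(** In [eps_le], [t = 2 Ce gamma^2] is the value for which the first term is
    bounded by [drop n]. The second one is quadratic in the dual error, which
    is controlled by the energy even if [eta] is exactly the squared norm of the
    stacked operator: then the energy misses [|a|^2], but [drop] contains
    [|r + a|^2] and the energy contains [|r|^2]. *)
Let eps_bound n :
  - (2 * eps n.+1) <= drop n + 4 * Ce * gamma n.+1 ^+ 2 / eta * (W n.+1 + W n).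
Proof.
have t0 : 0 < gamma n.+1 by exact: gamma_gt0.
have tt0 : 0 < 2 * Ce * gamma n.+1 ^+ 2 by rewrite !mulr_gt0 ?exprn_gt0.
apply: (le_trans (eps_le n tt0)); apply: lerD.
  have := prox_step_le t0 (primal_step n) (r_monotone n).
  have := sqr_normD_le (r n + a n.+1) (g n); rewrite -/(drop n).
  move: (`|r n + a n.+1 + g n| ^+ 2) (`|x n.+1 - x n| ^+ 2) (drop n) => u v w uw vu.
  rewrite -(ler_pM2l tt0) mulrA divff ?gt_eqF // mul1r.
  have -> : 2 * Ce * gamma n.+1 ^+ 2 * w = Ce * (gamma n.+1 ^+ 2 * (2 * w)) by ring.
  rewrite ler_pM2l //; apply: (le_trans vu).
  by rewrite ler_pM2l // exprn_gt0.
have hp : eta * p n.+2 <= 2 * (W n.+1 + W n).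
  apply: (le_trans (dual_le_energy n.+1)).
  have := sqr_normD_le (r n.+1 + a n.+2) (- r n.+1).
  rewrite [r n.+1 + _]addrC addrK normrN.
  have := r_le_energy n; have := drop_ge0 n.
  rewrite /W /drop; have := sqr_ge0 `|g n.+1|; rewrite [a n.+2 + _]addrC.
  have := sqr_ge0 `|r n.+1 + a n.+2|.
  have : 0 <= energy n.+2 by apply: le_trans (r_le_energy n.+1); rewrite sqr_ge0.
  move: (energy n.+1) (energy n.+2) => E1 E2.
  move: (`|r n + a n.+1| ^+ 2 + `|g n| ^+ 2) (`|g n.+1| ^+ 2) (`|r n.+1| ^+ 2).
  move: (`|r n.+1 + a n.+2| ^+ 2) (`|a n.+2| ^+ 2) => n1 n2 n3 n4 n5.
  lra.
have -> : 4 * Ce * gamma n.+1 ^+ 2 / eta * (W n.+1 + W n)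
  = 2 * Ce * gamma n.+1 ^+ 2 * (2 * (W n.+1 + W n) / eta) by ring.
by rewrite ler_pM2l // ler_pdivlMr // mulrC.
Qed.

Lemma energy_bounded : exists N B, forall n, (N <= n)%N ->
  (1 - 2 * gamma n.+1 * rho) / gamma n.+1 ^+ 2 * `|x n| ^+ 2 <= B.
Proof.
have [delta d0 [d1 hd]] := gamma_inv_growth rho_ge0 muR_ge0 rate_gt0 gamma_gt0 gamma_rec.
have k0 : 0 < (1 - kappa) / L by rewrite divr_gt0 // subr_gt0.
have y0 : 0 < eta / (8 * Ce) by rewrite divr_gt0 // mulr_gt0.
have [N1 hN1] := gamma_small rho_ge0 muR_ge0 rate_gt0 gamma_gt0 gamma_rec k0.
have e0 : 0 < Num.min 1 (eta / (8 * Ce)) by rewrite lt_min ltr01 y0.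
have [N2 hN2] := gamma_small rho_ge0 muR_ge0 rate_gt0 gamma_gt0 gamma_rec e0.
pose N := (N1 + N2).+1.
pose C := 16 * Ce / (eta * delta).
have C0 : 0 < C by rewrite divr_gt0 // mulr_gt0.
have E0 n : 0 <= energy n.+1 by apply: le_trans (r_le_energy n); rewrite sqr_ge0.
have W0 n : 0 <= W n by rewrite addr_ge0.
have hW n : (N <= n)%N -> W n.+1 <= (1 + (C * gamma n - C * gamma n.+1)) * W n.
  move=> Nn; have n1 : (1 <= n)%N by exact: leq_trans Nn.
  have Nn1 : (N1 <= n)%N by apply: leq_trans Nn; exact: leqW (leq_addr _ _).
  have Nn2 : (N2 <= n)%N by apply: leq_trans Nn; exact: leqW (leq_addl _ _).
  have s1 : gamma n.+2 <= (1 - kappa) / L  by apply: hN1; do 2![apply: leqW].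
  have : gamma n.+1 <= Num.min 1 (eta / (8 * Ce)) by apply: hN2; apply: leqW.
  rewrite le_min => /andP[s2 s3].
  have g0 : 0 < gamma n.+1 by exact: gamma_gt0.
  pose y := 4 * Ce * gamma n.+1 ^+ 2 / eta.
  have yE : y = 4 * Ce / eta * gamma n.+1 ^+ 2 by rewrite /y mulrAC.
  have c0 : 0 < 4 * Ce / eta by rewrite divr_gt0 // mulr_gt0.
  have y_ge0 : 0 <= y by rewrite yE mulr_ge0 ?sqr_ge0 // ltW.
  have y_half : y <= 1 / 2.
    have -> : 1 / 2 = 4 * Ce / eta * (eta / (8 * Ce)).
      by field; rewrite !gt_eqF.
    rewrite yE ler_pM2l //; apply: le_trans s3.
    by rewrite expr2 -[leRHS]mulr1 ler_pM2l.
  have y_tel : 4 * y <= C * gamma n - C * gamma n.+1.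
    have -> : C * gamma n - C * gamma n.+1
        = 4 * (4 * Ce / eta * ((gamma n - gamma n.+1) / delta)).
      by rewrite /C; field; rewrite !gt_eqF.
    rewrite yE ler_pM2l // ler_pM2l //.
    exact: (gamma_telescope rho_ge0 muR_ge0 gamma_gt0 gamma_rec d0 hd).
  have step : W n.+1 <= W n + y * (W n.+1 + W n).
    have := energy_descent s1; have := eps_bound n.
    rewrite -/y /W; move: (energy n.+2) (energy n.+1) (drop n.+1) (drop n).
    by move=> e1 e2 e3 e4 h1 h2; lra.
  apply: le_trans (_ : (1 + 4 * y) * W n <= _); last first.
    by rewrite ler_wpM2r // lerD2l.
  have := W0 n; have := W0 n.+1; move: (W n) (W n.+1) step => w w' step w'0 w0.
  have y1 : 0 < 1 - y by lra.
  rewrite -(ler_pM2l y1); apply: le_trans (_ : (1 + y) * w <= _); first by lra.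
  rewrite mulrA ler_wpM2r //.
  have : y * y <= 1 / 2 * y by rewrite ler_wpM2r.
  by lra.
exists N.+1, (expR (C * gamma N) * W N) => -[//|n]; rewrite ltnS => Nn.
apply: (le_trans (energy_ge n)).
apply: le_trans (_ : W n <= _); first by rewrite /W lerDl.
apply: (bounded_of_telescoping_growth (W := W) (g := fun n => C * gamma n)) => //.
by move=> k Nk; rewrite mulr_ge0 ?(ltW C0) // ltW // gamma_gt0 // (leq_trans _ Nk).
Qed.

End Descent.

(** * Weighted families of operators *)

Section WeightedSums.
Context {R : realType} {X : fdHilbertType R} {M : nat}.

(** The difference of the two sides is the weighted variance of [v]. *)
Lemma jensen_sqr_norm (w : 'I_M -> R) (v : 'I_M -> X) :
  (forall m, 0 <= w m) -> \sum_m w m = 1 ->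
  `|\sum_m w m *: v m| ^+ 2 <= \sum_m w m * `|v m| ^+ 2.
Proof.
move=> w0 w1; pose b := \sum_m w m *: v m.
have : 0 <= \sum_m w m * `|v m - b| ^+ 2.
  by apply: sumr_ge0 => m _; rewrite mulr_ge0 // sqr_ge0.
have -> : \sum_m w m * `|v m - b| ^+ 2 = (\sum_m w m * `|v m| ^+ 2) - `|b| ^+ 2.
  have -> : \sum_m w m * `|v m - b| ^+ 2
      = \sum_m (w m * `|v m| ^+ 2 - 2 * (w m * inner (v m) b) + w m * `|b| ^+ 2).
    by apply: eq_bigr => m _; rewrite sqr_normB; ring.
  rewrite big_split /= sumrB -mulr_sumr -mulr_suml w1 mul1r.
  have -> : \sum_m w m * inner (v m) b = `|b| ^+ 2.
    rewrite inner_norm {3}/b inner_suml; apply: eq_bigr => m _.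
    by rewrite innerZl.
  ring.
by rewrite subr_ge0.
Qed.

Lemma mean_cocoercive (L : 'I_M -> R) (g : 'I_M -> X) (d : X) : (0 < M)%N ->
  (forall m, 0 < L m) -> (forall m, `|g m| ^+ 2 <= 2 * L m * inner (g m) d) ->
  `|M%:R^-1 *: \sum_m g m| ^+ 2
    <= 2 * (\sum_m L m) * inner d (M%:R^-1 *: \sum_m g m).
Proof.
move=> M0 L0 gL; have M0' : 0 < M%:R :> R by rewrite ltr0n.
rewrite scaler_sumr innerC inner_suml mulr_sumr.
apply: (le_trans (jensen_sqr_norm (w := fun=> M%:R^-1) g _ _)) => [m||].
- by rewrite invr_ge0 ltW.
- by rewrite sumr_const card_ord -[_ *+ M]mulr_natr mulVf // gt_eqF.
apply: ler_sum => m _; rewrite innerZl [leRHS]mulrCA ler_pM2l ?invr_gt0 //.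
apply: (le_trans (gL m)); rewrite ler_wpM2r //.
  by rewrite -(pmulr_rge0 _ (L0 m)) -(pmulr_rge0 _ (ltr0Sn R 1)) mulrA (le_trans _ (gL m)) // sqr_ge0.
rewrite ler_pM2l // (bigD1 m) //= lerDl sumr_ge0 // => i _.
exact: ltW.
Qed.

End WeightedSums.

Section StackedOperator.
Context {R : realType} {X : fdHilbertType R} {M : nat}.
Context {U : 'I_M -> fdHilbertType R}.
Variables (K : forall m, {linear X -> U m}) (KT : forall m, {linear U m -> X}).
Variables (omega : 'I_M -> R) (eta : R).
Hypothesis KT_adjoint : forall m u x, inner (KT m u) x = inner (K m x) u.

Definition dual_map (u : forall m, U m) : X := \sum_m omega m *: KT m (u m).

Lemma dual_map_adjoint y u :
  \sum_m omega m * inner (K m y) (u m) = inner y (dual_map u).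
Proof.
rewrite innerC inner_suml; apply: eq_bigr => m _.
by rewrite innerZl KT_adjoint.
Qed.

Lemma dual_mapB u v : dual_map (fun m => u m - v m) = dual_map u - dual_map v.
Proof.
by rewrite -sumrB; apply: eq_bigr => m _; rewrite raddfB scalerBr.
Qed.

Lemma dual_map_le u : 0 < eta -> (forall m, 0 <= omega m) ->
  (forall y, \sum_m omega m * `|K m y| ^+ 2 <= eta * `|y| ^+ 2) ->
  `|dual_map u| ^+ 2 <= eta * \sum_m omega m * `|u m| ^+ 2.
Proof.
move=> eta0 w0 K_le; pose y := dual_map u.
have h : 2 * inner y y
    <= \sum_m omega m * (eta^-1 * `|K m y| ^+ 2 + eta * `|u m| ^+ 2).
  rewrite -dual_map_adjoint mulr_sumr; apply: ler_sum => m _.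
  by rewrite mulrCA ler_wpM2l // inner_young.
move: h; rewrite -inner_norm -/y.
under eq_bigr do rewrite mulrDr mulrCA [_ * (eta * _)]mulrCA.
rewrite big_split /= -!mulr_sumr => h.
have : eta^-1 * (\sum_m omega m * `|K m y| ^+ 2) <= `|y| ^+ 2.
  by rewrite ler_pdivrMl.
move: h; lra.
Qed.

End StackedOperator.

(** * From the algorithm to the abstract recursion *)

(** The algorithm near a critical point [xs], with the gradients abstracted to
    Lipschitz maps [gF m], the adjoints to linear maps [KT m], and the proximal
    steps to the monotonicity inequalities that they imply. *)
Section Trajectory.
Context {R : realType} {X : fdHilbertType R} {M : nat}.
Context {U : 'I_M -> fdHilbertType R}.
Variables (K : forall m, {linear X -> U m}) (KT : forall m, {linear U m -> X}).
Variables (gF : 'I_M -> X -> X) (LF omega : 'I_M -> R).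
Variables (muF muR kappa eta : R) (gamma : nat -> R).
Variables (x : nat -> X) (q : 'I_M -> nat -> X) (u : forall m, nat -> U m).
Variables (a : 'I_M -> nat -> X) (xs r : X) (h : forall m, U m).

Hypothesis M_gt0 : (0 < M)%N.
Hypothesis omega_gt0 : forall m, 0 < omega m.
Hypothesis omega_sum : \sum_m omega m = 1.
Hypothesis eta_gt0 : 0 < eta.
Hypothesis KT_adjoint : forall m u x, inner (KT m u) x = inner (K m x) u.
Hypothesis K_le : forall y, \sum_m omega m * `|K m y| ^+ 2 <= eta * `|y| ^+ 2.
Hypothesis LF_gt0 : forall m, 0 < LF m.
Hypothesis gF_lipschitz : forall m y z, `|gF m y - gF m z| <= LF m * `|y - z|.
Hypotheses (muF_ge0 : 0 <= muF) (muR_ge0 : 0 <= muR) (mu_gt0 : 0 < muF + muR).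
Hypotheses (kappa_gt0 : 0 < kappa) (kappa_lt1 : kappa < 1).
Hypothesis gamma_gt0 : forall k, 0 < gamma k.
Hypothesis gamma_rec : forall k, (1 <= k)%N ->
  (1 + 2 * gamma k * muR) * gamma k.+1 ^+ 2
    + 2 * gamma k ^+ 2 * (muF * kappa) * gamma k.+1 = gamma k ^+ 2.

Hypothesis q_step : forall m k, q m k.+1 =
  (M%:R * omega m / gamma k.+1) *: x k.+1 - gF m (x k.+1).
Hypothesis a_step : forall m k, a m k.+1 = q m k.+1 - KT m (u m k.+1).
Hypothesis critical0 :
  0 = M%:R^-1 *: (\sum_m (gF m xs + KT m (h m))) + r.

Let gbar z := M%:R^-1 *: \sum_m gF m z.
Let ghat m z := (M%:R * omega m)^-1 *: gF m z.
(** In the weighted product space the [m]-th components of the gradient and of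
    the dual variable are divided by [M omega_m]; their [omega]-weighted sums
    are then the averages that enter the primal step. *)
Let udual n m : U m := (M%:R * omega m)^-1 *: (u m n - h m).
(** The subgradient of the regularizer selected by the primal step. *)
Let rr n := (gamma n)^-1 *: ((gamma n / M%:R) *: (\sum_m a m n) - x n.+1).
(** The subgradient of the conjugate selected by the dual step. *)
Let v m n : U m := (M%:R * omega m / (gamma n.+1 * eta))^-1 *:
  (u m n + eta^-1 *: K m ((M%:R * omega m / gamma n) *: x n.+1 + q m n.+1 - q m n)
    - u m n.+1).

Hypothesis gbar_strong : forall y,
  muF * `|y - xs| ^+ 2 <= inner (y - xs) (gbar y - gbar xs).
Hypothesis gbar_cocoercive : forall y,
  `|gbar y - gbar xs| ^+ 2
    <= 2 * (\sum_m LF m) * inner (y - xs) (gbar y - gbar xs).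
Hypothesis rr_monotone : forall n, 0 <= inner (rr n.+1 - rr n) (x n.+2 - x n.+1).
Hypothesis rr_strong : forall n,
  muR * `|x n.+1 - xs| ^+ 2 <= inner (rr n - r) (x n.+1 - xs).
Hypothesis v_monotone : forall m n, 0 <= inner (v m n - K m xs) (u m n.+1 - h m).

Let MR_gt0 : 0 < M%:R :> R. Proof. by rewrite ltr0n. Qed.

Let Mw_gt0 m : 0 < M%:R * omega m. Proof. by rewrite mulr_gt0. Qed.

Let dm n := dual_map KT omega (udual n).

Let dmE n : dm n = M%:R^-1 *: (\sum_m KT m (u m n)) - M%:R^-1 *: \sum_m KT m (h m).
Proof.
rewrite -scalerBr -sumrB scaler_sumr; apply: eq_bigr => m _.
rewrite /udual linearZ raddfB scalerA; congr (_ *: _).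
by field; rewrite !gt_eqF.
Qed.

Let averageE n : (gamma n.+1 / M%:R) *: \sum_m a m n.+1 =
  x n.+1 - gamma n.+1 *: (gbar (x n.+1) + M%:R^-1 *: \sum_m KT m (u m n.+1)).
Proof.
under eq_bigr do rewrite a_step q_step -addrA -opprD.
rewrite sumrB -scaler_suml scalerBr scalerA; congr (_ - _).
  rewrite -mulr_suml -mulr_sumr omega_sum mulr1.
  have -> : gamma n.+1 / M%:R * (M%:R / gamma n.+1) = 1.
    by field; rewrite !gt_eqF.
  by rewrite scale1r.
by rewrite big_split /= -scalerDr scalerA.
Qed.

Let primal_step n : (x n.+2 - xs) + gamma n.+1 *: (rr n.+1 - r) =
  (x n.+1 - xs) - gamma n.+1 *: ((gbar (x n.+1) - gbar xs) + dm n.+1).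
Proof.
have rE : r = - (gbar xs + M%:R^-1 *: \sum_m KT m (h m)).
  by apply/eqP; rewrite -addr_eq0 addrC -scalerDr -big_split /= -critical0.
have e : gamma n.+1 *: rr n.+1 =
    x n.+1 - gamma n.+1 *: (gbar (x n.+1) + M%:R^-1 *: \sum_m KT m (u m n.+1)) - x n.+2.
  by rewrite /rr scalerA divff ?gt_eqF // scale1r averageE.
rewrite scalerBr e dmE rE.
move: (gbar _) (gbar xs) (_ *: \sum_m KT m (h m)) (_ *: \sum_m KT m _) => g g' k k'.
apply: inner_ext => z; rewrite !innerE; ring.
Qed.

(** The increment of the [m]-th gradient in the product space minus that of the
    mean gradient. It vanishes when the rescaled gradients coincide. *)
Let err n m := (ghat m (x n.+2) - ghat m (x n.+1)) - (gbar (x n.+2) - gbar (x n.+1)).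

(** The extrapolated point of the dual step is the one that would be obtained
    with the averaged quantities, up to [err]: [primal_step] expresses the last
    displacement of [x] by the averages at the previous step. *)
Let dual_argument n m :
  (gamma n.+2 / (M%:R * omega m)) *:
     ((M%:R * omega m / gamma n.+1) *: x n.+2 + q m n.+2 - q m n.+1)
  = xs + (x n.+2 - xs - gamma n.+2 *: ((rr n.+1 - r) + dm n.+1
        + (gbar (x n.+2) - gbar xs))) - gamma n.+2 *: err n m.
Proof.
have e : (rr n.+1 - r) + dm n.+1 =
    (gamma n.+1)^-1 *: (x n.+1 - x n.+2) - (gbar (x n.+1) - gbar xs).
  apply: (scalerI (lt0r_neq0 (gamma_gt0 n.+1))).
  rewrite scalerBr scalerA divff ?gt_eqF // scale1r scalerDr.
  have := primal_step n; move=> /(congr1 (fun z => z - (x n.+2 - xs))).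
  rewrite [X in X - _]addrC addrK => ->.
  move: (gbar _) (gbar xs) (dm _) => g g' k.
  apply: inner_ext => z; rewrite !innerE; ring.
rewrite e !q_step /err /ghat.
move: (gF m (x n.+2)) (gF m (x n.+1)) (gbar (x n.+2)) (gbar (x n.+1)) (gbar xs).
move=> g2 g1 b2 b1 bs.
have key (w t t' i1 i2 i3 i4 i5 i6 i7 i8 : R) : 0 < w -> 0 < t -> 0 < t' ->
    t' / w * (w / t * i6 + (w / t' * i6 - i5) - (w / t * i4 - i3)) =
    i2 + (i6 - i2 - t' * (t^-1 * (i4 - i6) - (i1 - i8) + (i7 - i8))) -
    t' * (w^-1 * i5 - w^-1 * i3 - (i7 - i1)).
  by move=> w0 t0 t'0; field; rewrite !gt_eqF.
apply: inner_ext => z; rewrite !innerE.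
by apply: key.
Qed.

Let vE n m : v m n.+1 - K m xs =
  (gamma n.+2 * eta) *: (udual n.+1 m - udual n.+2 m)
  + (K m (x n.+2 - xs - gamma n.+2 *: ((rr n.+1 - r) + dm n.+1
        + (gbar (x n.+2) - gbar xs))) - gamma n.+2 *: K m (err n m)).
Proof.
rewrite -(linearZ_LR (K m)) -(raddfB (K m)).
have -> : v m n.+1 = (gamma n.+2 * eta) *: (udual n.+1 m - udual n.+2 m)
   + K m ((gamma n.+2 / (M%:R * omega m)) *:
     ((M%:R * omega m / gamma n.+1) *: x n.+2 + q m n.+2 - q m n.+1)).
  have key (w t e i1 i2 i3 k : R) : 0 < w -> 0 < t -> 0 < e ->
      (w / (t * e))^-1 * (i1 + e^-1 * k - i2)
      = t * e * (w^-1 * (i1 - i3) - w^-1 * (i2 - i3)) + t / w * k.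
    by move=> w0 t0 e0; field; rewrite !gt_eqF.
  rewrite /v (linearZ_LR (K m)) /udual; move: (K m _) => k.
  apply: inner_ext => z; rewrite !innerE.
  by apply: key.
rewrite dual_argument -addrA -(raddfB (K m)); congr (_ + K m _).
by rewrite -[xs + _ - _]addrA [xs + _]addrC addrK.
Qed.

Let pp n := \sum_m omega m * `|udual n m| ^+ 2.
Let ss n := \sum_m omega m * inner (udual n m) (udual n.+1 m).
(** The index is shifted because [err n] belongs to the step from [n.+1] to
    [n.+2]. *)
Let eps n := \sum_m omega m * inner (K m (err n.-1 m)) (udual n.+1 m).

Let dual_step n :
  0 <= inner (x n.+2 - xs - gamma n.+2 *: ((rr n.+1 - r) + dm n.+1
        + (gbar (x n.+2) - gbar xs))) (dm n.+2)
       + gamma n.+2 * (eta * (ss n.+1 - pp n.+2)) - gamma n.+2 * eps n.+1.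
Proof.
set y := x n.+2 - xs - _.
have : 0 <= \sum_m omega m * inner (v m n.+1 - K m xs) (udual n.+2 m).
  apply: sumr_ge0 => m _; rewrite innerZr; apply: mulr_ge0; first exact: ltW.
  by rewrite mulr_ge0 // invr_ge0 ltW.
have -> : \sum_m omega m * inner (v m n.+1 - K m xs) (udual n.+2 m) =
  \sum_m (omega m * inner (K m y) (udual n.+2 m)
   + gamma n.+2 * eta * (omega m * inner (udual n.+1 m) (udual n.+2 m)
        - omega m * `|udual n.+2 m| ^+ 2)
   - gamma n.+2 * (omega m * inner (K m (err n m)) (udual n.+2 m))).
  apply: eq_bigr => m _; rewrite vE -/y inner_norm.
  move: (K m y) (K m (err n m)) (udual n.+1 m) (udual n.+2 m) => k1 k2 u1 u2.
  rewrite !innerE; ring.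
rewrite sumrB big_split /= -!mulr_sumr sumrB (dual_map_adjoint omega KT_adjoint) mulrA.
by [].
Qed.

Let lipschitz_const m := (M%:R * omega m)^-1 * LF m + M%:R^-1 * \sum_i LF i.

Let err_le n m : `|err n m| <= lipschitz_const m * `|x n.+2 - x n.+1|.
Proof.
rewrite /err /ghat /gbar -!scalerBr -sumrB.
apply: (le_trans (ler_normB _ _)); rewrite mulrDl !normrZ.
rewrite !ger0_norm ?invr_ge0 ?(ltW MR_gt0) ?(ltW (Mw_gt0 m)) // -!mulrA.
apply: lerD; first by rewrite ler_wpM2l ?invr_ge0 // ltW.
rewrite ler_wpM2l ?invr_ge0 ?(ltW MR_gt0) //.
apply: (le_trans (ler_norm_sum _ _ _)); rewrite mulr_suml.
by apply: ler_sum => i _.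
Qed.

Let Ce := eta * (\sum_m lipschitz_const m ^+ 2) + 1.

Let K_err_le n :
  \sum_m omega m * `|K m (err n m)| ^+ 2 <= Ce * `|x n.+2 - x n.+1| ^+ 2.
Proof.
apply: le_trans (_ : eta * (\sum_m lipschitz_const m ^+ 2) * `|x n.+2 - x n.+1| ^+ 2 <= _).
  rewrite -mulrA mulr_suml mulr_sumr; apply: ler_sum => m _.
  apply: le_trans (_ : eta * `|err n m| ^+ 2 <= _).
    apply: le_trans (K_le (err n m)); rewrite [leRHS](bigD1 m) //= lerDl.
    by apply: sumr_ge0 => i _; rewrite mulr_ge0 ?sqr_ge0 // ltW.
  rewrite ler_pM2l // -exprMn; apply: lerXn2r; rewrite ?nnegrE //.
  exact: le_trans (normr_ge0 _) (err_le n m).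
by rewrite ler_wpM2r ?sqr_ge0 // /Ce lerDl.
Qed.

Let eps_le n t : 0 < t -> - (2 * eps n.+1)
  <= t^-1 * (Ce * `|(x n.+2 - xs) - (x n.+1 - xs)| ^+ 2) + t * pp n.+2.
Proof.
move=> t0; have -> : x n.+2 - xs - (x n.+1 - xs) = x n.+2 - x n.+1.
  by rewrite opprB addrA subrK.
apply: le_trans (_ : t^-1 * (\sum_m omega m * `|K m (err n m)| ^+ 2) + t * pp n.+2 <= _).
  rewrite /eps /pp !mulr_sumr -sumrN -big_split; apply: ler_sum => m _ /=.
  have := inner_young (- K m (err n m)) (udual n.+2 m) t0.
  rewrite innerNl normrN => /(ler_wpM2l (ltW (omega_gt0 m))).
  lra.
by rewrite lerD2r ler_pM2l ?invr_gt0 // K_err_le.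
Qed.

Lemma trajectory_bounded : exists N B, forall n, (N <= n)%N ->
  (1 - 2 * gamma n.+1 * (muF * kappa)) / gamma n.+1 ^+ 2 * `|x n.+1 - xs| ^+ 2 <= B.
Proof.
have L0 : 0 < 2 * \sum_m LF m.
  rewrite mulr_gt0 // (bigD1 (Ordinal M_gt0)) //= ltr_pwDl //.
  by apply: sumr_ge0 => i _; exact: ltW.
have Ce0 : 0 < Ce.
  rewrite /Ce ltr_wpDl // mulr_ge0 ?(ltW eta_gt0) // sumr_ge0 // => m _.
  exact: sqr_ge0.
have w0 m : 0 <= omega m by exact: ltW.
apply: (energy_bounded (x := fun n => x n.+1 - xs) (r := fun n => rr n - r)
  (g := fun n => gbar (x n.+1) - gbar xs) (a := dm) (p := pp) (s := ss) (eps := eps)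
  muF_ge0 muR_ge0 mu_gt0 kappa_gt0 kappa_lt1 L0 Ce0 eta_gt0) => //.
- move=> n; rewrite -dual_mapB.
  apply: (le_trans (dual_map_le KT_adjoint _ eta_gt0 w0 K_le)).
  rewrite ler_pM2l // /pp /ss mulr_sumr -sumrB -big_split; apply: ler_sum => m _ /=.
  by rewrite sqr_normB; lra.
- by move=> n; exact: (dual_map_le KT_adjoint _ eta_gt0 w0 K_le).
- move=> n; have := rr_monotone n.
  have -> : rr n.+1 - r - (rr n - r) = rr n.+1 - rr n by rewrite opprB addrA subrK.
  by have -> : x n.+2 - xs - (x n.+1 - xs) = x n.+2 - x n.+1 by rewrite opprB addrA subrK.
- by move=> n; rewrite innerC.
Qed.

End Trajectory.

(** * Stacked norms, the rate and the theorem *)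

Section StackedNorm.
Context {R : realType} {X : fdHilbertType R} {M : nat}.
Context {U : 'I_M -> fdHilbertType R}.
Variables (K : forall m, {linear X -> U m}) (omega : 'I_M -> R) (eta : R).
Hypotheses (omega_ge0 : forall m, 0 <= omega m) (omega_sum : \sum_m omega m = 1).

Lemma stacked_le_max (y : X) :
  \big[Num.max/0]_m (opnorm (K m) ^+ 2) <= eta ->
  \sum_m omega m * `|K m y| ^+ 2 <= eta * `|y| ^+ 2.
Proof.
move=> le_eta; rewrite -[eta]mul1r -omega_sum !mulr_suml; apply: ler_sum => m _.
rewrite -mulrA ler_wpM2l //.
apply: le_trans (_ : opnorm (K m) ^+ 2 * `|y| ^+ 2 <= _).
  have h := opnormP (linearP (K m)) y.
  rewrite -exprMn; apply: lerXn2r; rewrite ?nnegrE //.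
  exact: le_trans (normr_ge0 _) h.
rewrite ler_wpM2r ?sqr_ge0 //; apply: le_trans le_eta.
exact: (le_bigmax 0 (fun m => opnorm (K m) ^+ 2) m).
Qed.

Lemma stacked_le_gram (y : X) :
  opnorm (fun x : X => \sum_m omega m *: adjoint (K m) (K m x)) <= eta ->
  \sum_m omega m * `|K m y| ^+ 2 <= eta * `|y| ^+ 2.
Proof.
set T := (fun x : X => _) => le_eta.
have T_lin : linear T.
  move=> c v w; rewrite /T scaler_sumr -big_split; apply: eq_bigr => m _ /=.
  by rewrite linearP linearP scalerDr !scalerA mulrC.
have -> : \sum_m omega m * `|K m y| ^+ 2 = inner (T y) y.
  rewrite inner_suml; apply: eq_bigr => m _.
  by rewrite innerZl adjointP inner_norm.
apply: (le_trans (cauchy_schwarz _ _)).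
rewrite expr2 mulrA ler_wpM2r //; apply: (le_trans (opnormP T_lin y)).
by rewrite ler_wpM2r.
Qed.

End StackedNorm.

Section Rate.
Context {R : realType} {V : normedModType R}.
Variables (rho sigma : R) (gamma : nat -> R) (x : nat -> V) (xs : V).
Hypotheses (rho_ge0 : 0 <= rho) (sigma_ge0 : 0 <= sigma).
Hypothesis rate_gt0 : 0 < rho + sigma.
Hypothesis gamma_gt0 : forall k, (1 <= k)%N -> 0 < gamma k.
Hypothesis gamma_rec : forall k, (1 <= k)%N ->
  (1 + 2 * gamma k * sigma) * gamma k.+1 ^+ 2
    + 2 * gamma k ^+ 2 * rho * gamma k.+1 = gamma k ^+ 2.

Let slack := 1 - 2 * gamma 2 * rho.

Let slack_gt0 : 0 < slack.
Proof.
by have /andP[] := gamma_slack rho_ge0 sigma_ge0 gamma_gt0 gamma_rec (leqnn 2).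
Qed.

Let slack_le k : (1 <= k)%N ->
  slack <= 1 - 2 * gamma k.+1 * rho <= 1 - gamma k.+1 * rho.
Proof.
move=> k1; have k2 : (2 <= k.+1)%N by [].
have /andP[_ ->] := gamma_slack rho_ge0 sigma_ge0 gamma_gt0 gamma_rec k2.
have : 0 <= gamma k.+1 * rho by rewrite mulr_ge0 // ltW // gamma_gt0.
by rewrite /=; lra.
Qed.

(** The factor [1 - 2 gamma rho] of the energy may be replaced by
    [1 - gamma rho] because it stays above a positive constant; the finitely many
    indices below [N] are absorbed into [c0]. *)
Lemma rate_constant N B :
  (forall n, (N <= n)%N ->
    (1 - 2 * gamma n.+1 * rho) / gamma n.+1 ^+ 2 * `|x n.+1 - xs| ^+ 2 <= B) ->
  exists2 c0, 0 < c0 & forall k, (1 <= k)%N ->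
    `|x k.+1 - xs| ^+ 2 <= gamma k.+1 ^+ 2 / (1 - gamma k.+1 * rho) * c0.
Proof.
move=> hB.
pose T k := `|x k.+1 - xs| ^+ 2 * ((1 - gamma k.+1 * rho) / gamma k.+1 ^+ 2).
pose c0 := 1 + `|B| / slack + \sum_(i < N) `|T i|.
have S0 : 0 <= \sum_(i < N) `|T i| by apply: sumr_ge0.
have B0 : 0 <= `|B| / slack by rewrite divr_ge0 // ltW.
exists c0; first by rewrite /c0 -addrA ltr_pwDl // addr_ge0.
move=> k k1; have /andP[h1 h2] := slack_le k1.
have g0 : 0 < gamma k.+1 by exact: gamma_gt0.
have d0 : 0 < 1 - gamma k.+1 * rho by apply: lt_le_trans slack_gt0 (le_trans h1 h2).
have Tc0 : T k <= c0.
  have [Nk|kN] := leqP N k; last first.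
    apply: (le_trans (ler_norm _)); rewrite /c0.
    apply: le_trans (_ : \sum_(i < N) `|T i| <= _).
      by rewrite (bigD1 (Ordinal kN)) //= lerDl sumr_ge0.
    by rewrite lerDr addr_ge0.
  apply: le_trans (_ : `|B| / slack <= _); last first.
    by rewrite /c0 addrAC lerDr addr_ge0.
  rewrite ler_pdivlMr //; apply: le_trans (le_trans (hB k Nk) (ler_norm B)).
  rewrite /T [leLHS]mulrC -[leRHS]mulrA [leLHS]mulrCA.
  rewrite [(1 - gamma k.+1 * rho) / _]mulrC.
  have n0 : 0 <= (gamma k.+1 ^+ 2)^-1 * `|x k.+1 - xs| ^+ 2.
    by rewrite mulr_ge0 ?sqr_ge0 // invr_ge0 sqr_ge0.
  have d1 : 1 - gamma k.+1 * rho <= 1.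
    by rewrite gerBl mulr_ge0 // ltW.
  have := ler_pM (ltW slack_gt0) (ltW d0) h1 d1.
  rewrite mulr1 => /(ler_wpM2r n0); lra.
rewrite mulrC mulrA ler_pdivlMr // mulrC [leRHS]mulrC.
by move: Tc0; rewrite /T mulrA ler_pdivrMr ?exprn_gt0 // [c0 * _]mulrC mulrC [leRHS]mulrC.
Qed.

Lemma rate_bigO (c0 : R) : 0 < c0 ->
  (fun k : nat => gamma k.+1 ^+ 2 / (1 - gamma k.+1 * rho) * c0)
  =O_\oo (fun k : nat => (k%:R ^+ 2)^-1 : R).
Proof.
move=> c00; have [delta d0 [d1 hd]] :=
  gamma_inv_growth rho_ge0 sigma_ge0 rate_gt0 gamma_gt0 gamma_rec.
apply/eqO_exP; exists (c0 / (slack * delta ^+ 2)).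
  by rewrite divr_gt0 // mulr_gt0 // exprn_gt0.
exists 1%N => // k /= k1; have /andP[h1 h2] := slack_le k1.
have g0 : 0 < gamma k.+1 by exact: gamma_gt0.
have d0' : 0 < 1 - gamma k.+1 * rho by apply: lt_le_trans slack_gt0 (le_trans h1 h2).
have k0 : 0 < k%:R :> R by rewrite ltr0n.
rewrite !ger0_norm ?invr_ge0 ?sqr_ge0 //; last first.
  by rewrite mulr_ge0 ?(ltW c00) // divr_ge0 ?sqr_ge0 // ltW.
have gk : gamma k.+1 <= (delta * k%:R)^-1.
  apply: le_trans (gamma_le_inv gamma_gt0 d0 d1 hd k1).
  exact: (gamma_decr rho_ge0 sigma_ge0 gamma_gt0 gamma_rec k1).
have -> : c0 / (slack * delta ^+ 2) * (k%:R ^+ 2)^-1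
    = (delta * k%:R)^-1 ^+ 2 / slack * c0.
  by field; rewrite !gt_eqF.
rewrite ler_pM2r // ler_pM ?sqr_ge0 ?invr_ge0 ?(ltW d0') //.
  by apply: lerXn2r; rewrite ?nnegrE ?invr_ge0 ?mulr_ge0 ?(ltW g0) ?(ltW d0) ?(ltW k0).
by rewrite lef_pV2 ?posrE // (le_trans h1).
Qed.

End Rate.

Theorem theorem7 (R : realType) (M : nat) (hM : (1 <= M)%N)
  (X : fdHilbertType R) (U : 'I_M -> fdHilbertType R)
  (K : forall m, {linear X -> U m})
  (Reg : X -> \bar R) (H : forall m, U m -> \bar R) (F : 'I_M -> X -> R)
  (LF omega : 'I_M -> R) (LFhat muF muR : R)
  (hReg : proper_closed_convex Reg)
  (hH : forall m, proper_closed_convex (@H m))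
  (hFconvex : forall m, convex_function [set: X] (F m))
  (hLF : forall m, 0 < LF m)
  (hFsmooth : forall m, smooth (LF m) (F m))
  (homega : forall m, 0 < omega m)
  (homega1 : \sum_(m < M) omega m = 1)
  (hLFhat : 0 < LFhat)
  (hLFhatP : forall x x' : X,
    (M%:R ^+ 2)^-1 *
      (\sum_(m < M) (omega m)^-1 * `|grad (F m) x - grad (F m) x'| ^+ 2)
    <= LFhat ^+ 2 * `|x - x'| ^+ 2)
  (hmuF : 0 <= muF)
  (hmuFP : convex_function [set: X]
    (fun x : X => M%:R^-1 * (\sum_(m < M) F m x) - muF / 2 * `|x| ^+ 2))
  (hmuR : 0 <= muR)
  (hmuRP : convex_efun
    (fun x : X => (Reg x - (muR / 2 * `|x| ^+ 2)%:E)%E))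
  (hcritical : exists xs : X, critical F H K Reg xs)
  (hmu : 0 < muF + muR)
  (kappa : R) (hkappa : 0 < kappa < 1)
  (gamma : nat -> R)
  (hgamma0 : 0 < gamma 0%N < 2 * (1 - kappa) / LFhat)
  (hgamma1 : gamma 1%N = gamma 0%N)
  (hgamma : forall k, (1 <= k)%N ->
    gamma k.+1 =
      (- (gamma k ^+ 2 * muF * kappa)
       + gamma k * Num.sqrt ((gamma k * muF * kappa) ^+ 2
                             + 1 + 2 * gamma k * muR))
      / (1 + 2 * gamma k * muR))
  (normK2 eta : R)
  (hnormK2 : normK2 = \big[Num.max/0]_(m < M) (opnorm (K m) ^+ 2) \/
    ((forall m m', F m = F m') /\
     normK2 = opnorm (fun x : X =>
                \sum_(m < M) omega m *: adjoint (K m) (K m x))))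
  (heta0 : 0 < eta) (heta : normK2 <= eta)
  (x : nat -> X) (q : 'I_M -> nat -> X) (u : forall m, nat -> U m)
  (a : 'I_M -> nat -> X)
  (hPD3O : distributed_PD3O F H K Reg omega gamma eta x q u a) :
  exists xstar : X,
    [/\ argmin (Psi F H K Reg) xstar,
        forall y, argmin (Psi F H K Reg) y -> y = xstar &
        exists c0 : R,
          [/\ 0 < c0,
              forall k, (1 <= k)%N ->
                `|x k.+1 - xstar| ^+ 2
                <= gamma k.+1 ^+ 2 / (1 - gamma k.+1 * muF * kappa) * c0 &
              (fun k : nat =>
                 gamma k.+1 ^+ 2 / (1 - gamma k.+1 * muF * kappa) * c0)
              =O_\oo (fun k : nat => (k%:R ^+ 2)^-1 : R)]].
Proof.
case: hcritical => xs [h [r [h_sub r_sub crit0]]].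
have [k0 k1] := andP hkappa; have [g00 _] := andP hgamma0.
have [x_step q_step u_step a_step] :
  [/\ forall k, x k.+1 = prox (fun z => (gamma k)%:E * Reg z)%E
                              ((gamma k / M%:R) *: \sum_(m < M) a m k),
      forall m k, q m k.+1 =
        (M%:R * omega m / gamma k.+1) *: x k.+1 - grad (F m) (x k.+1),
      forall m k, u m k.+1 =
        prox (fun z => (M%:R * omega m / (gamma k.+1 * eta))%:E
                       * conjugate (@H m) z)%E
             (u m k + eta^-1 *:
                K m ((M%:R * omega m / gamma k) *: x k.+1
                     + q m k.+1 - q m k)) &
      forall m k, a m k.+1 = q m k.+1 - adjoint (K m) (u m k.+1)] by case: hPD3O.
have MR0 : 0 < M%:R :> R by rewrite ltr0n.
have rho0 : 0 <= muF * kappa by rewrite mulr_ge0 // ltW.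
have gq k : 0 < gamma k.+1 -> 0 < gamma k.+2 /\
    (1 + 2 * gamma k.+1 * muR) * gamma k.+2 ^+ 2
      + 2 * gamma k.+1 ^+ 2 * (muF * kappa) * gamma k.+2 = gamma k.+1 ^+ 2.
  by move=> gk; apply: stepsize_quadratic => //; rewrite hgamma // !mulrA.
have gS k : 0 < gamma k.+1.
  by elim: k => [|k /gq[]//]; rewrite hgamma1.
have g_gt0 k : 0 < gamma k by case: k.
have g_gt0' k : (1 <= k)%N -> 0 < gamma k by [].
have g_rec k : (1 <= k)%N -> (1 + 2 * gamma k * muR) * gamma k.+1 ^+ 2
    + 2 * gamma k ^+ 2 * (muF * kappa) * gamma k.+1 = gamma k ^+ 2.
  by case: k => // k _; have [] := gq k (gS k).
have rate0 : 0 < muF * kappa + muR.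
  have [m0|m0] := ltP 0 muR; first by rewrite ltr_wpDl.
  have m1 : 0 < muF by apply: (lt_le_trans hmu); rewrite gerDl.
  by rewrite ltr_pwDl // mulr_gt0.
(* Both definitions of the norm are used only through this inequality. *)
have K_le y : \sum_m omega m * `|K m y| ^+ 2 <= eta * `|y| ^+ 2.
  have w0 m : 0 <= omega m by exact: ltW.
  case: hnormK2 => [e|[_ e]]; rewrite e in heta.
    exact: stacked_le_max.
  exact: stacked_le_gram.
have [pReg lReg cReg] := hReg.
have dF m y : differentiable (F m) y by have [] := hFsmooth m.
have gF_lip m y z : `|grad (F m) y - grad (F m) z| <= LF m * `|y - z|.
  exact: smooth_lipschitz.
have gF_sub m y z : F m y + inner (grad (F m) y) (z - y) <= F m z.
  exact: convex_gradient_le.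
have mean_growth y d := mean_strong_convexity dF y d hmuFP.
have gF_coco m y z := cocoercive (hLF m) (gF_sub m) (gF_lip m) y z.
have [psi Psi_xs Psi_ge] : exists2 w : R, Psi F H K Reg xs = w%:E &
    forall y, ((w + (muF + muR) / 2 * `|y - xs| ^+ 2)%:E <= Psi F H K Reg y)%E.
  apply: (Psi_growth (gF := fun m => grad (F m)) _ pReg hmuRP mean_growth h_sub r_sub crit0).
  by move=> m; have [] := hH m.
have Psi_min : argmin (Psi F H K Reg) xs.
  move=> y; apply: le_trans (Psi_ge y); rewrite Psi_xs lee_fin lerDl.
  by rewrite mulr_ge0 ?sqr_ge0 // divr_ge0 // ltW.
exists xs; split=> // [y /(_ xs)|].
  rewrite Psi_xs => /(le_trans (Psi_ge y)).
  rewrite lee_fin gerDl pmulr_rle0 ?divr_gt0 // => n0.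
  by apply/subr0_eq/eqP; rewrite -normr_eq0 -sqrf_eq0 eq_le n0 sqr_ge0.
have r_iter k : subdiff Reg (x k.+1)
    ((gamma k)^-1 *: ((gamma k / M%:R) *: \sum_m a m k - x k.+1)).
  by rewrite x_step; exact: prox_subdiff (g_gt0 k) pReg lReg cReg r_sub.
have u_mono m k : 0 <= inner ((M%:R * omega m / (gamma k.+1 * eta))^-1 *:
    (u m k + eta^-1 *: K m ((M%:R * omega m / gamma k) *: x k.+1 + q m k.+1 - q m k)
      - u m k.+1) - K m xs) (u m k.+1 - h m).
  have [pH _ _] := hH m; have [b Hb] := subdiff_real pH (h_sub m).
  have c0 : 0 < M%:R * omega m / (gamma k.+1 * eta) by rewrite divr_gt0 // mulr_gt0.
  have pH' := conjugate_proper Hb (h_sub m).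
  have cH' := conjugate_convex pH; have lH' := conjugate_lsc pH.
  have sH' := subdiff_conjugate Hb (h_sub m).
(* The critical point supplies the subgradient K m xs of the conjugate at h m. *)
  apply: (subdiff_monotone pH' cH' _ sH'); rewrite u_step.
  exact: prox_subdiff c0 pH' lH' cH' sH'.
have [N [B hB]] : exists N B, forall n, (N <= n)%N ->
    (1 - 2 * gamma n.+1 * (muF * kappa)) / gamma n.+1 ^+ 2 * `|x n.+1 - xs| ^+ 2 <= B.
  apply: (trajectory_bounded (K := K) (KT := fun m => adjoint (K m))
    (gF := fun m => grad (F m)) (LF := LF) (omega := omega) (eta := eta)
    (q := q) (u := u) (a := a) (r := r) (h := h) _ _ _ _ _ _ _ _ hmuF hmuR hmu k0 k1
    g_gt0 g_rec q_step a_step crit0) => //.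
  - by move=> m w y; exact: adjointP.
  - by move=> y; exact: (strong_growth_monotone mean_growth).
  - by move=> y; rewrite -scalerBr -sumrB; apply: mean_cocoercive.
  - move=> k; exact: subdiff_monotone pReg cReg (r_iter k.+1) (r_iter k).
  - by move=> k; exact: subdiff_strongly_monotone pReg hmuRP (r_iter k) r_sub.
have [c0 c0_gt0 hc0] := rate_constant rho0 hmuR g_gt0' g_rec hB.
exists c0; split=> //.
  by move=> k k1'; have := hc0 k k1'; rewrite !mulrA.
have := rate_bigO rho0 hmuR rate0 g_gt0' g_rec c0_gt0.
by under eq_fun do rewrite mulrA.
Qed.
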